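(* Let $((R_\lambda)_{\lambda\in\Omega},(\phi_{\mu,\lambda})_{\mu\ge\lambda})$ be a direct system of (associative, not necessarily unital) rings. (i) If all $R_\lambda$ are dense (this is the case, for example, if $R_\lambda^2=R_\lambda$ for all $\lambda$), then $\varinjlim R_\lambda$ is also dense and $\Lambda(\varinjlim R_\lambda)=\varinjlim_{\mathrm{Cu}}\Lambda(R_\lambda)$. (ii) If all $R_\lambda$ are left normal, then $\varinjlim R_\lambda$ is also left normal and $\mathrm S(\varinjlim R_\lambda)=\varinjlim_{\mathrm{Cu}}\mathrm S(R_\lambda)$.
   Context: $M_\infty(R)$ is the ring of infinite matrices over $R$ with finitely many nonzero entries. For $x,y\in M_\infty(R)$, $x\precsim_1 y$ means $x=syt$ for some $s,t\in M_\infty(R)$. $x\oplus y$ denotes the infinite matrix represented by the block diagonal matrix $\mathrm{diag}(x,y)$, where $x,y$ are replaced by finite square upper-left corners containing all their nonzero entries. $T(R)=\{(x_n)_{n\ge1}: x_n\in M_\infty(R),\ x_n\precsim_1 x_{n+1}\ \forall n\}$, and $\mathcal S(R)=\{(x_n)\in T(R): \forall n\ \exists y_{n+1}\in M_\infty(R),\ x_n=y_{n+1}x_{n+1}x_n\}$. For $(x_n),(y_n)\in T(R)$ write $(x_n)\precsim(y_n)$ if for every $n$ there is $m$ with $x_n\precsim_1 y_m$, and $(x_n)\sim(y_n)$ if $(x_n)\precsim (y_n)$ and $(y_n)\precsim(x_n)$. Put $\Lambda(R)=T(R)/{\sim}$ and $\mathrm S(R)=\mathcal S(R)/{\sim}\subseteq\Lambda(R)$,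 with the order induced by $\precsim$ and addition $[(x_n)]+[(y_n)]=[(x_n\oplus y_n)]$; these are positively ordered commutative monoids. A ring homomorphism $\phi\colon R\to R'$ induces $\Lambda(\phi)\colon\Lambda(R)\to\Lambda(R')$, $[(x_n)]\mapsto[(\phi(x_n))]$, which restricts to $\mathrm S(\phi)\colon \mathrm S(R)\to\mathrm S(R')$. $R$ is dense if whenever $x\precsim_1 y$ in $M_\infty(R)$ there is $z\in M_\infty(R)$ with $x\precsim_1 z\precsim_1 y$. $R$ is left normal if for all $a,b,c\in M_\infty(R)$ with $a=ba$ and $b=cb$ there exist $d,e\in M_\infty(R)$ with $a=da$, $d=ed$, $e=ce$. In a partially ordered set where increasing sequences have suprema, $x\ll y$ means: for every increasing sequence $(z_n)$ with $y\le\sup_n z_n$ there is $m$ with $x\le z_m$. The category $\mathrm{Cu}$ has as objects the positively ordered monoids $S$ satisfying: (O1) increasing sequences have suprema; (O2) every element is the supremum of a sequence $(x_n)$ with $x_n\ll x_{n+1}$ for all $n$; (O3) $x'\ll x$, $y'\ll y$ imply $x'+y'\ll x+y$; (O4) $\sup_n(x_n+y_n)=\sup_n x_n+\sup_n y_n$ for increasing sequences. Its morphisms are the monoid maps preserving order, $\ll$ and suprema of increasing sequences. For a dense (resp. left normal) ring $R$, $\Lambda(R)$ (resp. $\mathrm S(R)$) is an object of $\mathrm{Cu}$. The equalities in the claim mean that $\Lambda(\varinjlim R_\lambda)$ (resp. $\mathrm S(\varinjlim R_\lambda)$), with the maps induced by the limit maps $R_\lambda\to\varinjlim R_\lambda$,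 is the direct limit in $\mathrm{Cu}$ of the induced direct system. *)

(* Defs.v *)
From HB Require Import structures.
From mathcomp Require Import all_boot all_order ssralg generic_quotient.
From mathcomp Require Import mathcomp_extra boolp classical_sets functions.
From mathcomp Require Import cardinality fsbigop.

Set Implicit Arguments.
Unset Strict Implicit.
Unset Printing Implicit Defensive.

Import Order.TTheory GRing.Theory.
Local Open Scope classical_set_scope.
Local Open Scope ring_scope.

(* Associative, not necessarily unital; the library's pzRingType has a unit.  *)
HB.mixin Record Zmodule_isRng R of GRing.Zmodule R := {
  rng_mul : R -> R -> R;
  rmulA : associative rng_mul;
  rmulDl : left_distributive rng_mul +%R;
  rmulDr : right_distributive rng_mul +%R
}.

#[short(type="rngType")]
HB.structure Definition Rng := {R of GRing.Zmodule R & Zmodule_isRng R}.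

Notation "x ** y" := (rng_mul x y) (at level 40, left associativity) : ring_scope.

HB.mixin Record isRngMultiplicative (R S : rngType) (f : R -> S) := {
  rmorphMr : {morph f : x y / x ** y}
}.

HB.structure Definition RngMorphism (R S : rngType) :=
  {f of @GRing.Additive R S f & isRngMultiplicative R S f}.

Notation "{ 'rngmorphism' U -> V }" := (RngMorphism.type U%type V%type)
  (at level 0, U at level 98, V at level 99,
   format "{ 'rngmorphism'  U  ->  V }") : type_scope.

Section RngTheory.
Variable R : rngType.
Implicit Types x y : R.

Lemma rmul0 x : 0 ** x = 0.
Proof. by apply: (@addrI _ (0 ** x)); rewrite -rmulDl !addr0. Qed.

Lemma rmulr0 x : x ** 0 = 0.
Proof. by apply: (@addrI _ (x ** 0)); rewrite -rmulDr !addr0. Qed.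

Lemma rmul_suml (I : Type) (r : seq I) (F : I -> R) y :
  (\sum_(i <- r) F i) ** y = \sum_(i <- r) F i ** y.
Proof.
by apply: (big_morph (fun x => x ** y)) => [a b|]; rewrite ?rmulDl ?rmul0.
Qed.

Lemma rmul_sumr (I : Type) (r : seq I) (F : I -> R) y :
  y ** (\sum_(i <- r) F i) = \sum_(i <- r) y ** F i.
Proof.
by apply: (big_morph (rng_mul y)) => [a b|]; rewrite ?rmulDr ?rmulr0.
Qed.

(* The ideal R^2: finite sums of products.                                    *)
Definition rng_square : set R :=
  [set x | exists n (a b : 'I_n -> R), x = \sum_(i < n) a i ** b i].

Definition precsim1 x y := exists s t : R, x = s ** y ** t.

Lemma precsim1_trans y x z : precsim1 x y -> precsim1 y z -> precsim1 x z.
Proof.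
move=> [s [t ->]] [s' [t' ->]]; exists (s ** s'), (t' ** t).
by rewrite !rmulA.
Qed.

End RngTheory.

Arguments rng_square : clear implicits.

Lemma precsim1_morph (R S : rngType) (f : {rngmorphism R -> S}) x y :
  precsim1 x y -> precsim1 (f x) (f y).
Proof. by move=> [s [t ->]]; exists (f s), (f t); rewrite !rmorphMr. Qed.

Record minf (R : rngType) := Minf {
  mcoef :> nat -> nat -> R;
  minf_finite : finite_set [set ij : nat * nat | mcoef ij.1 ij.2 != 0]
}.

HB.instance Definition _ R := gen_eqMixin (minf R).
HB.instance Definition _ R := gen_choiceMixin (minf R).

Section MinfRing.
Variable R : rngType.
Implicit Types x y z : minf R.

Definition corner n (x : nat -> nat -> R) :=
  forall i j, x i j != 0 -> (i < n)%N && (j < n)%N.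

Lemma corner_finite n (x : nat -> nat -> R) : corner n x ->
  finite_set [set ij : nat * nat | x ij.1 ij.2 != 0].
Proof.
move=> xn; apply: (@sub_finite_set _ _ (`I_n `*` `I_n)).
  by move=> [i j] /= /xn /andP[].
exact: finite_setX.
Qed.

Lemma finite_corner (x : nat -> nat -> R) :
  finite_set [set ij : nat * nat | x ij.1 ij.2 != 0] -> exists n, corner n x.
Proof.
move=> /finite_seqP[s xs].
exists (\max_(ij <- s) (maxn ij.1 ij.2)).+1 => i j xij.
have : (i, j) \in s by have : [set` s] (i, j) by rewrite -xs.
move=> ins.
have := @leq_bigmax_seq _ s predT (fun ij : nat * nat => maxn ij.1 ij.2) _ ins isT.
by rewrite !ltnS geq_max.
Qed.

Lemma minf_corner x : exists n, corner n x.
Proof. exact/finite_corner/minf_finite. Qed.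

Lemma corner_le m n x : (m <= n)%N -> corner m x -> corner n x.
Proof.
by move=> mn cx i j /cx /andP[im jm]; rewrite !(leq_trans _ mn).
Qed.

Lemma corner_row n x i j : corner n x -> (n <= i)%N -> x i j = 0.
Proof.
move=> cx ni; apply/eqP; apply: contraTT ni => /cx /andP[].
by rewrite -ltnNge.
Qed.

Lemma corner_col n x i j : corner n x -> (n <= j)%N -> x i j = 0.
Proof.
move=> cx ni; apply/eqP; apply: contraTT ni => /cx /andP[].
by rewrite -ltnNge.
Qed.

Lemma minfP x y : (forall i j, x i j = y i j) -> x = y.
Proof.
case: x y => [x fx] [y fy] /= xy.
have exy : x = y by apply/funext => i; apply/funext => j.
by move: fx fy; rewrite exy => fx fy; congr Minf; exact: Prop_irrelevance.
Qed.

Lemma fsum_bound n (F : nat -> R) : (forall k, (n <= k)%N -> F k = 0) ->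
  \sum_(k \in [set: nat]) F k = \sum_(k < n) F k.
Proof.
move=> F0; rewrite (@fsbig_ord _ 0 +%R) -(@fsbig_widen _ _ 0 +%R `I_n)//.
by move=> k [_ /= /negP]; rewrite -leqNgt => /F0.
Qed.

Definition minf0_subproof : finite_set
  [set ij : nat * nat | (fun _ _ : nat => 0 : R) ij.1 ij.2 != 0].
Proof. by apply: (@corner_finite 0) => i j; rewrite eqxx. Qed.
Definition minf0 := Minf minf0_subproof.

Lemma minf_opp_subproof x :
  finite_set [set ij : nat * nat | (fun i j => - x i j) ij.1 ij.2 != 0].
Proof.
have [n cx] := minf_corner x.
by apply: (@corner_finite n (fun i j => - x i j)) => i j; rewrite oppr_eq0 => /cx.
Qed.
Definition minf_opp x := Minf (@minf_opp_subproof x).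

Lemma minf_add_subproof x y :
  finite_set [set ij : nat * nat | (fun i j => x i j + y i j) ij.1 ij.2 != 0].
Proof.
have [n cx] := minf_corner x; have [m cy] := minf_corner y.
apply: (@corner_finite (maxn n m) (fun i j => x i j + y i j)) => i j.
have [x0|x0 _] := eqVneq (x i j) 0; last first.
  exact: (corner_le (leq_maxl _ _) cx).
by rewrite x0 add0r; apply: (corner_le (leq_maxr _ _) cy).
Qed.
Definition minf_add x y := Minf (@minf_add_subproof x y).

Lemma minf_addA : associative minf_add.
Proof. by move=> x y z; apply: minfP => i j /=; rewrite addrA. Qed.
Lemma minf_addC : commutative minf_add.
Proof. by move=> x y; apply: minfP => i j /=; rewrite addrC. Qed.
Lemma minf_add0 : left_id minf0 minf_add.
Proof. by move=> x; apply: minfP => i j /=; rewrite add0r. Qed.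
Lemma minf_addN : left_inverse minf0 minf_opp minf_add.
Proof. by move=> x; apply: minfP => i j /=; rewrite addNr. Qed.

HB.instance Definition _ := GRing.isZmodule.Build (minf R)
  minf_addA minf_addC minf_add0 minf_addN.

Definition minf_mulf x y (i j : nat) : R :=
  \sum_(k \in [set: nat]) (x i k ** y k j).

Lemma minf_mulfE x y n i j : corner n x \/ corner n y ->
  minf_mulf x y i j = \sum_(k < n) x i k ** y k j.
Proof.
move=> cxy; apply: fsum_bound => k nk.
case: cxy => c; first by rewrite (corner_col _ c nk) rmul0.
by rewrite (corner_row _ c nk) rmulr0.
Qed.

Lemma minf_mul_corner n x y : corner n x -> corner n y ->
  corner n (minf_mulf x y).
Proof.
move=> cx cy i j; rewrite (@minf_mulfE x y n); last by left.
move=> nz; apply/andP; split; rewrite ltnNge; apply: contraNN nz => nij.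
  by rewrite big1// => k _; rewrite (corner_row _ cx nij) rmul0.
by rewrite big1// => k _; rewrite (corner_col _ cy nij) rmulr0.
Qed.

Lemma minf_corner2 x y : exists n, corner n x /\ corner n y.
Proof.
have [n cx] := minf_corner x; have [m cy] := minf_corner y.
by exists (maxn n m); split;
  [exact: corner_le (leq_maxl _ _) cx|exact: corner_le (leq_maxr _ _) cy].
Qed.

Lemma minf_mul_subproof x y :
  finite_set [set ij : nat * nat | (minf_mulf x y) ij.1 ij.2 != 0].
Proof.
have [n [cx cy]] := minf_corner2 x y.
exact/corner_finite/(minf_mul_corner cx cy).
Qed.
Definition minf_mul x y := Minf (@minf_mul_subproof x y).

Lemma minf_mulA : associative minf_mul.
Proof.
move=> x y z; apply: minfP => i j /=.
have [n1 [cx1 cy1]] := minf_corner2 x y; have [n2 cz2] := minf_corner z.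
pose n := maxn n1 n2.
have cx : corner n x by exact: corner_le (leq_maxl _ _) cx1.
have cy : corner n y by exact: corner_le (leq_maxl _ _) cy1.
have cz : corner n z by exact: corner_le (leq_maxr _ _) cz2.
rewrite (@minf_mulfE _ _ n); last by left.
rewrite (@minf_mulfE _ _ n); last by right.
under eq_bigr => k _.
  rewrite /= (@minf_mulfE _ _ n); last by left.
  rewrite rmul_sumr; over.
rewrite exchange_big; apply: eq_bigr => k _.
rewrite /= (@minf_mulfE _ _ n); last by left.
by rewrite rmul_suml; apply: eq_bigr => l _; rewrite rmulA.
Qed.

Lemma minf_mulDl : left_distributive minf_mul +%R.
Proof.
move=> x y z; apply: minfP => i j /=.
have [n cz] := minf_corner z.
rewrite !(@minf_mulfE _ _ n); try by right.
by rewrite -big_split; apply: eq_bigr => k _; exact: rmulDl.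
Qed.

Lemma minf_mulDr : right_distributive minf_mul +%R.
Proof.
move=> x y z; apply: minfP => i j /=.
have [n cz] := minf_corner x.
rewrite !(@minf_mulfE _ _ n); try by left.
by rewrite -big_split; apply: eq_bigr => k _; exact: rmulDr.
Qed.

HB.instance Definition _ := Zmodule_isRng.Build (minf R)
  minf_mulA minf_mulDl minf_mulDr.

Lemma minf_mulE x y n i j : corner n x \/ corner n y ->
  (x ** y) i j = \sum_(k < n) x i k ** y k j.
Proof. exact: minf_mulfE. Qed.

End MinfRing.

Section MinfMap.
Variables (R S : rngType) (f : {rngmorphism R -> S}).

Lemma map_minf_corner n (x : minf R) : corner n x ->
  corner n (fun i j => f (x i j)).
Proof.
by move=> cx i j fx; apply: cx; apply: contraNN fx => /eqP ->; rewrite raddf0.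
Qed.

Lemma map_minf_subproof (x : minf R) :
  finite_set [set ij : nat * nat | (fun i j => f (x i j)) ij.1 ij.2 != 0].
Proof.
have [n cx] := minf_corner x.
exact: (@corner_finite _ n (fun i j => f (x i j)) (map_minf_corner cx)).
Qed.
Definition map_minf (x : minf R) := Minf (@map_minf_subproof x).

Lemma map_minf_additive : nmod_morphism map_minf.
Proof.
split; first by apply: minfP => i j /=; rewrite raddf0.
by move=> x y; apply: minfP => i j /=; rewrite raddfD.
Qed.
HB.instance Definition _ :=
  GRing.isNmodMorphism.Build (minf R) (minf S) map_minf map_minf_additive.

Lemma map_minf_mul : {morph map_minf : x y / x ** y}.
Proof.
move=> x y; apply: minfP => i j; change (f ((x ** y) i j) = (map_minf x ** map_minf y) i j).
have [n cx] := minf_corner x.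
rewrite (@minf_mulE _ x y n); last by left.
rewrite (@minf_mulE _ (map_minf x) _ n); last by left; exact: map_minf_corner.
by rewrite raddf_sum; apply: eq_bigr => k _; exact: rmorphMr.
Qed.
HB.instance Definition _ :=
  isRngMultiplicative.Build (minf R) (minf S) map_minf map_minf_mul.
End MinfMap.

(* 2 x 2 block matrices with respect to an injection [dec] of the index set   *)
(* nat into nat + nat; only used in proofs, to compare the block sums for     *)
(* different corner sizes and for the even/odd splitting [par].               *)
Section Blocks.
Variable R : rngType.
Implicit Types p q r s x y z : minf R.

Definition untag2 (u : nat + nat) := match u with inl k => k | inr k => k end.

Record decoding := Decoding {
  dec :> nat -> nat + nat;
  dec_dom : pred nat;
  dec_bound : forall m, exists n, forall i, (untag2 (dec i) < m)%N -> (i < n)%N;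
  dec_sum : forall (F : nat + nat -> R) m,
    (forall u, (m <= untag2 u)%N -> F u = 0) ->
    (forall k, ~~ dec_dom k -> F (inl k) = 0) ->
    \sum_(k \in [set: nat]) F (dec k) =
      \sum_(k < m) F (inl (k : nat)) + \sum_(k < m) F (inr (k : nat))
}.

Definition cutf n i : nat + nat := if (i < n)%N then inl i else inr (i - n)%N.

Fact cut_bound b m :
  exists n, forall i, (untag2 (cutf b i) < m)%N -> (i < n)%N.
Proof.
exists (b + m)%N => i; rewrite /cutf; case: (ltnP i b) => /= ib.
  by rewrite ltn_addr.
by rewrite ltn_subLR.
Qed.

Fact cut_sum b (F : nat + nat -> R) m :
  (forall u, (m <= untag2 u)%N -> F u = 0) ->
  (forall k, ~~ (k < b)%N -> F (inl k) = 0) ->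
  \sum_(k \in [set: nat]) F (cutf b k) =
    \sum_(k < m) F (inl (k : nat)) + \sum_(k < m) F (inr (k : nat)).
Proof.
move=> Fm Fb; rewrite (@fsum_bound _ (b + m)); last first.
  move=> k bk; apply: Fm; rewrite /cutf ltnNge (leq_trans (leq_addr _ _) bk) /=.
  by rewrite leq_subRL// (leq_trans (leq_addr _ _) bk).
rewrite big_split_ord /=; congr (_ + _); last first.
  by apply: eq_bigr => k _; rewrite /cutf ltnNge leq_addr /= addKn.
rewrite -(@fsum_bound _ m (fun k => F (inl k))); last first.
  by move=> k mk; exact: Fm.
rewrite (@fsum_bound _ b); last by move=> k; rewrite leqNgt => /Fb.
by apply: eq_bigr => k _; rewrite /cutf ltn_ord.
Qed.

Definition cut b := Decoding (cut_bound b) (@cut_sum b).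

Definition parf i : nat + nat := if odd i then inr i./2 else inl i./2.

Fact par_bound m :
  exists n, forall i, (untag2 (parf i) < m)%N -> (i < n)%N.
Proof.
exists (m.*2)%N => i; rewrite /parf; case: ifP => /= oi;
  by rewrite -ltn_double -{2}(odd_double_half i) oi //= add1n ltn_Sdouble ltn_double.
Qed.

Fact par_sum (F : nat + nat -> R) m :
  (forall u, (m <= untag2 u)%N -> F u = 0) ->
  (forall k, ~~ predT k -> F (inl k) = 0) ->
  \sum_(k \in [set: nat]) F (parf k) =
    \sum_(k < m) F (inl (k : nat)) + \sum_(k < m) F (inr (k : nat)).
Proof.
move=> Fm _; rewrite (@fsum_bound _ m.*2); last first.
  move=> k mk; apply: Fm; rewrite /parf.
  by case: ifP => _ /=; rewrite -(doubleK m) half_leq.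
elim: m {Fm} => [|m IH]; first by rewrite !big_ord0 addr0.
rewrite doubleS !big_ord_recr /= IH /parf /= odd_double /= doubleK.
by rewrite uphalf_double addrACA addrA.
Qed.

Definition par := Decoding par_bound par_sum.

Definition blkf (d e : decoding) p q r s (i j : nat) : R :=
  match d i, e j with
  | inl i, inl j => p i j
  | inl i, inr j => q i j
  | inr i, inl j => r i j
  | inr i, inr j => s i j
  end.

Lemma minf_corner4 p q r s :
  exists n, [/\ corner n p, corner n q, corner n r & corner n s].
Proof.
have [n [cp cq]] := minf_corner2 p q; have [m [cr cs]] := minf_corner2 r s.
exists (maxn n m); split.
- exact: corner_le (leq_maxl _ _) cp.
- exact: corner_le (leq_maxl _ _) cq.
- exact: corner_le (leq_maxr _ _) cr.
- exact: corner_le (leq_maxr _ _) cs.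
Qed.

Lemma blkf_finite d e p q r s :
  finite_set [set ij : nat * nat | blkf d e p q r s ij.1 ij.2 != 0].
Proof.
have [m [cp cq cr cs]] := minf_corner4 p q r s.
have [n1 dn] := dec_bound d m; have [n2 en] := dec_bound e m.
apply: (@corner_finite _ (maxn n1 n2)) => i j nz.
suff /andP[im jm] : (untag2 (d i) < m)%N && (untag2 (e j) < m)%N.
  apply/andP; split; first by rewrite (leq_trans (dn _ im))// leq_maxl.
  by rewrite (leq_trans (en _ jm))// leq_maxr.
by move: nz; rewrite /blkf; case: (d i) => k; case: (e j) => l /=;
  [exact: cp|exact: cq|exact: cr|exact: cs].
Qed.

Definition blk d e p q r s := Minf (blkf_finite d e p q r s).

Lemma mul_blk d e f p q r s p' q' r' s' :
  (forall k, ~~ dec_dom e k ->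
     (forall i, p i k = 0 /\ r i k = 0) \/ (forall j, p' k j = 0 /\ q' k j = 0)) ->
  blk d e p q r s ** blk e f p' q' r' s' =
  blk d f (p ** p' + q ** r') (p ** q' + q ** s')
          (r ** p' + s ** r') (r ** q' + s ** s').
Proof.
move=> dom; apply: minfP => i j.
have [m [cp cq cr cs]] := minf_corner4 p q r s.
pose F (u : nat + nat) : R :=
  (match d i, u with
  | inl i, inl j => p i j | inl i, inr j => q i j
  | inr i, inl j => r i j | inr i, inr j => s i j end) **
  (match u, f j with
  | inl i, inl j => p' i j | inl i, inr j => q' i j
  | inr i, inl j => r' i j | inr i, inr j => s' i j end).
transitivity (\sum_(k \in [set: nat]) F (e k)); first by [].
rewrite (@dec_sum e F m); last 2 first.
- move=> u mu; rewrite /F; case: (d i) => k; case: u mu => l /= ml.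
  + by rewrite (corner_col _ cp ml) rmul0.
  + by rewrite (corner_col _ cq ml) rmul0.
  + by rewrite (corner_col _ cr ml) rmul0.
  + by rewrite (corner_col _ cs ml) rmul0.
- move=> k /dom[] ek; rewrite /F.
    by case: (d i) => l; have [E1 E2] := ek l; rewrite ?E1 ?E2 rmul0.
  by case: (f j) => l; have [E1 E2] := ek l; rewrite ?E1 ?E2 rmulr0.
rewrite /F /= /blkf; case: (d i) => k; case: (f j) => l /=;
by rewrite !(@minf_mulfE _ _ _ m); by [|left].
Qed.

Lemma mul_dblk d e f p s p' s' :
  (forall k, ~~ dec_dom e k ->
     (forall i, p i k = 0) \/ (forall j, p' k j = 0)) ->
  blk d e p 0 0 s ** blk e f p' 0 0 s' = blk d f (p ** p') 0 0 (s ** s').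
Proof.
move=> dom; rewrite mul_blk ?(rmul0, rmulr0, addr0, add0r)//.
by move=> k /dom[] H; [left|right].
Qed.

Lemma precsim1_blk d e x y x' y' :
  (forall k, ~~ dec_dom e k -> forall i, x' i k = 0 /\ x' k i = 0) ->
  precsim1 x x' -> precsim1 y y' ->
  precsim1 (blk d d x 0 0 y) (blk e e x' 0 0 y').
Proof.
move=> cx [s [t ->]] [s' [t' ->]].
exists (blk d e s 0 0 s'), (blk e d t 0 0 t').
rewrite !mul_dblk//.
- move=> k /cx H; left => i /=; rewrite /minf_mulf fsbig1// => l _.
  by rewrite (H l).1 rmulr0.
- by move=> k /cx H; right => j; rewrite (H j).2.
Qed.

Lemma precsim1_blkC d e x y x' y' :
  (forall k, ~~ dec_dom e k -> forall i, y' i k = 0 /\ y' k i = 0) ->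
  precsim1 x x' -> precsim1 y y' ->
  precsim1 (blk d d x 0 0 y) (blk e e y' 0 0 x').
Proof.
move=> cx [s [t ->]] [s' [t' ->]].
exists (blk d e 0 s s' 0), (blk e d 0 t' t 0).
rewrite !mul_blk ?(rmul0, rmulr0, addr0, add0r)//.
- move=> k /cx H; left => i; split=> //=; rewrite /minf_mulf fsbig1// => l _.
  by rewrite (H l).1 rmulr0.
- by move=> k /cx H; right => j; rewrite (H j).2.
Qed.

End Blocks.

Section BlockSum.
Variable R : rngType.
Implicit Types x y z : minf R.

(* diag(x, y), where x is cut to its upper-left n x n corner.                 *)
Definition bdiagf n x y (i j : nat) : R :=
  if (i < n)%N && (j < n)%N then x i j
  else if (n <= i)%N && (n <= j)%N then y (i - n)%N (j - n)%N else 0.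

Lemma bdiagfE n x y i j :
  bdiagf n x y i j = blk (cut R n) (cut R n) x 0 0 y i j.
Proof.
by rewrite /bdiagf /= /blkf /= /cutf; case: ltnP => ni; case: ltnP => nj.
Qed.

Lemma bdiag_subproof n x y :
  finite_set [set ij : nat * nat | bdiagf n x y ij.1 ij.2 != 0].
Proof.
have -> : bdiagf n x y = blk (cut R n) (cut R n) x 0 0 y :> (nat -> nat -> R).
  by apply/funext => i; apply/funext => j; exact: bdiagfE.
exact: minf_finite.
Qed.

Definition bdiag n x y := Minf (bdiag_subproof n x y).

Lemma bdiagE n x y : bdiag n x y = blk (cut R n) (cut R n) x 0 0 y.
Proof. by apply: minfP => i j; exact: bdiagfE. Qed.

Lemma mdim_subproof x : exists n, `[< corner n x >].
Proof. by have [n cx] := minf_corner x; exists n; apply/asboolP. Qed.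

Definition mdim x := ex_minn (mdim_subproof x).

Lemma mdimP x : corner (mdim x) x.
Proof. by rewrite /mdim; case: ex_minnP => n /asboolP. Qed.

(* The corner of x is the smallest one that contains its nonzero entries;     *)
(* by [tdsum_class] below, any other choice gives the same sum in Lambda R.   *)
Definition dsum x y := bdiag (mdim x) x y.

Lemma corner_dom n x : corner n x ->
  forall k, ~~ dec_dom (cut R n) k -> forall i, x i k = 0 /\ x k i = 0.
Proof.
move=> cx k /=; rewrite -leqNgt => nk i.
by rewrite (corner_row _ cx nk) (corner_col _ cx nk).
Qed.

Lemma precsim1_bdiag m n x y x' y' : corner n x' ->
  precsim1 x x' -> precsim1 y y' -> precsim1 (bdiag m x y) (bdiag n x' y').
Proof.
move=> cx xx' yy'; rewrite !bdiagE; apply: precsim1_blk xx' yy'.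
exact: corner_dom.
Qed.

Lemma precsim1_bdiagC m n x y x' y' : corner n y' ->
  precsim1 x x' -> precsim1 y y' -> precsim1 (bdiag m x y) (bdiag n y' x').
Proof.
move=> cy xx' yy'; rewrite !bdiagE; apply: precsim1_blkC xx' yy'.
exact: corner_dom.
Qed.

Lemma bdiag0x x : bdiag 0 0 x = x.
Proof. by apply: minfP => i j; rewrite /= /bdiagf /= !subn0. Qed.

Lemma bdiag_corner m n x y : corner m x -> corner n y ->
  corner (m + n) (bdiag m x y).
Proof.
move=> cx cy i j; rewrite /= /bdiagf; case: ifP => [/andP[im jm] _|_].
  by rewrite !ltn_addr.
case: ifP => [/andP[im jm] /cy|]; last by rewrite eqxx.
by rewrite !ltn_subLR.
Qed.

Lemma bdiagA m n x y z : corner m x ->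
  bdiag (m + n) (bdiag m x y) z = bdiag m x (bdiag n y z).
Proof.
move=> cx; apply: minfP => i j; rewrite /= /bdiagf /=.
have [im|mi] := ltnP i m; have [jm|mj] := ltnP j m => /=.
- by rewrite /bdiagf im jm !ltn_addr.
- rewrite (ltn_addr _ im) /=; case: ltnP => nj /=.
    by rewrite /bdiagf im (leqNgt m i) im /= ltnNge mj.
  by rewrite leqNgt (ltn_addr _ im).
- rewrite (ltn_addr _ jm) andbT; case: ltnP => ni /=.
    by rewrite /bdiagf jm (leqNgt m j) jm andbF /= ltnNge mi.
  by rewrite (leqNgt _ j) (ltn_addr _ jm).
- rewrite /= /bdiagf !ltn_subLR// !leq_subRL// !subnDA.
  by case: ifP => // _; rewrite !ltnNge mi mj /=.
Qed.

End BlockSum.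

(* The order is a field of its own mixin: HB rejects a join of GRing.Nmodule   *)
(* and Order.POrder declared after Num.POrderedZmodule.                        *)
HB.mixin Record isPositivelyOrdered M of GRing.Nmodule M := {
  pole : M -> M -> Prop;
  pole_refl : forall x, pole x x;
  pole_anti : forall x y, pole x y -> pole y x -> x = y;
  pole_trans : forall y x z, pole x y -> pole y z -> pole x z;
  pole0 : forall x, pole 0 x;
  pole_add2r : forall z x y, pole x y -> pole (x + z) (y + z)
}.

#[short(type="poMonoidType")]
HB.structure Definition POMonoid := {M of GRing.Nmodule M & isPositivelyOrdered M}.

Notation "x <=m y" := (pole x y) (at level 70, no associativity).

Section Cu.
Variable M : poMonoidType.
Implicit Types (x y : M) (z w : nat -> M).

Definition increasing z := forall n, z n <=m z n.+1.

Definition is_sup z x :=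
  (forall n, z n <=m x) /\ (forall y, (forall n, z n <=m y) -> x <=m y).

Definition way_below x y := forall z s,
  increasing z -> is_sup z s -> y <=m s -> exists m, x <=m z m.

Record is_Cu : Prop := IsCu {
  Cu_O1 : forall z, increasing z -> exists s, is_sup z s;
  Cu_O2 : forall x, exists z,
    (forall n, way_below (z n) (z n.+1)) /\ is_sup z x;
  Cu_O3 : forall x' x y' y,
    way_below x' x -> way_below y' y -> way_below (x' + y') (x + y);
  Cu_O4 : forall z w s t, increasing z -> increasing w ->
    is_sup z s -> is_sup w t -> is_sup (fun n => z n + w n) (s + t)
}.

End Cu.

Record Cu_morphism (M N : poMonoidType) (f : M -> N) : Prop := CuMorphism {
  Cu_morD : nmod_morphism f;
  Cu_mor_le : forall x y, x <=m y -> f x <=m f y;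
  Cu_mor_ll : forall x y, way_below x y -> way_below (f x) (f y);
  Cu_mor_sup : forall (z : nat -> M) s,
    increasing z -> is_sup z s -> is_sup (fun n => f (z n)) (f s)
}.

(* T(R), with sequences indexed from 0.                                       *)
Record Tseq (R : rngType) := TSeq {
  tseq :> nat -> minf R;
  tseqP : forall n, precsim1 (tseq n) (tseq n.+1)
}.

HB.instance Definition _ R := gen_eqMixin (Tseq R).
HB.instance Definition _ R := gen_choiceMixin (Tseq R).

Section TseqTheory.
Variable R : rngType.
Implicit Types x y z : Tseq R.

Definition precsim x y := forall n, exists m, precsim1 (x n) (y m).

Definition tsim x y := precsim x y /\ precsim y x.

Lemma tseq_lt x m n : (m < n)%N -> precsim1 (x m) (x n).
Proof.
elim: n => // n IH; rewrite ltnS leq_eqVlt => /predU1P[->|/IH xmn].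
  exact: tseqP.
exact: precsim1_trans xmn (tseqP _ _).
Qed.

Lemma precsim_refl x : precsim x x.
Proof. by move=> n; exists n.+1; exact: tseqP. Qed.

Lemma precsim_trans y x z : precsim x y -> precsim y z -> precsim x z.
Proof.
move=> xy yz n; have [m xm] := xy n; have [k yk] := yz m.
by exists k; exact: precsim1_trans xm yk.
Qed.

Definition tsimb : rel (Tseq R) := fun x y => `[< tsim x y >].

Lemma tsimb_refl : reflexive tsimb.
Proof. by move=> x; apply/asboolP; split; exact: precsim_refl. Qed.

Lemma tsimb_sym : symmetric tsimb.
Proof. by move=> x y; apply/asboolP/asboolP => -[]. Qed.

Lemma tsimb_trans : transitive tsimb.
Proof.
move=> y x z /asboolP[xy yx] /asboolP[yz zy]; apply/asboolP.
by split; [exact: precsim_trans xy yz|exact: precsim_trans zy yx].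
Qed.

Canonical tsim_equiv := EquivRel tsimb tsimb_refl tsimb_sym tsimb_trans.

Lemma tdsum_subproof x y n :
  precsim1 (dsum (x n) (y n)) (dsum (x n.+1) (y n.+1)).
Proof. by apply: precsim1_bdiag; [exact: mdimP|exact: tseqP|exact: tseqP]. Qed.

Definition tdsum x y := TSeq (tdsum_subproof x y).

Lemma tdsumE x y n : tdsum x y n = bdiag (mdim (x n)) (x n) (y n).
Proof. by []. Qed.

Lemma tseq_common x y x' y' n : precsim x x' -> precsim y y' ->
  exists m, precsim1 (x n) (x' m) /\ precsim1 (y n) (y' m).
Proof.
move=> xx' yy'; have [m1 h1] := xx' n; have [m2 h2] := yy' n.
exists (maxn m1 m2).+1; split.
  by apply: precsim1_trans h1 (tseq_lt _ _); rewrite ltnS leq_maxl.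
by apply: precsim1_trans h2 (tseq_lt _ _); rewrite ltnS leq_maxr.
Qed.

Lemma precsim_bdiag x y x' y' (u v : Tseq R) (M N : nat -> nat) :
  (forall n, u n = bdiag (M n) (x n) (y n)) ->
  (forall n, v n = bdiag (N n) (x' n) (y' n)) ->
  (forall n, corner (N n) (x' n)) ->
  precsim x x' -> precsim y y' -> precsim u v.
Proof.
move=> uE vE cN xx' yy' n.
have [m [h1 h2]] := tseq_common n xx' yy'.
by exists m; rewrite uE vE; exact: precsim1_bdiag.
Qed.

Lemma precsim_bdiagC x y (u v : Tseq R) (M N : nat -> nat) :
  (forall n, u n = bdiag (M n) (x n) (y n)) ->
  (forall n, v n = bdiag (N n) (y n) (x n)) ->
  (forall n, corner (N n) (y n)) -> precsim u v.
Proof.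
move=> uE vE cN n; exists n.+1; rewrite uE vE.
by apply: precsim1_bdiagC => //; exact: tseqP.
Qed.

Lemma tzero_subproof (n : nat) : precsim1 (0 : minf R) 0.
Proof. by exists 0, 0; rewrite !rmul0. Qed.

Definition tzero := TSeq tzero_subproof.

End TseqTheory.

Local Open Scope quotient_scope.

(* [tsim_equiv R] is the relation [tsim] as a boolean equivalence.            *)
Definition Lambda (R : rngType) := {eq_quot (tsim_equiv R)}.

HB.instance Definition _ R := Choice.on (Lambda R).
HB.instance Definition _ R := EqQuotient.on (Lambda R).

Section LambdaMonoid.
Variable R : rngType.
Implicit Types (x y z : Tseq R) (a b c : Lambda R).

Definition tclass x : Lambda R := \pi_(Lambda R) x.

Lemma tclassP x y : tclass x = tclass y <-> tsim x y.
Proof.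
split=> [/eqmodP /asboolP//|xy].
by apply/eqmodP/asboolP.
Qed.

Lemma tclass_repr a : tclass (repr a) = a.
Proof. exact: reprK. Qed.

Lemma repr_tclass x : tsim (repr (tclass x)) x.
Proof. by apply/tclassP; rewrite tclass_repr. Qed.

Definition Lambda_le a b := precsim (repr a) (repr b).

Lemma Lambda_leE x y : Lambda_le (tclass x) (tclass y) <-> precsim x y.
Proof.
have [rx xr] := repr_tclass x; have [ry yr] := repr_tclass y.
split=> xy.
  exact: precsim_trans xr (precsim_trans xy ry).
exact: precsim_trans rx (precsim_trans xy yr).
Qed.

Definition Lambda_add a b := tclass (tdsum (repr a) (repr b)).

Lemma tdsum_class x y (N : nat -> nat) z :
  (forall n, corner (N n) (x n)) ->
  (forall n, z n = bdiag (N n) (x n) (y n)) ->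
  Lambda_add (tclass x) (tclass y) = tclass z.
Proof.
move=> cN zE.
have [rx xr] := repr_tclass x; have [ry yr] := repr_tclass y.
apply/tclassP; split; first exact: precsim_bdiag (tdsumE _ _) zE cN rx ry.
by apply: precsim_bdiag zE (tdsumE _ _) _ xr yr => n; exact: mdimP.
Qed.

Lemma Lambda_addE x y :
  Lambda_add (tclass x) (tclass y) = tclass (tdsum x y).
Proof. by apply: tdsum_class => // n; exact: mdimP. Qed.

Lemma Lambda_addA : associative Lambda_add.
Proof.
move=> a b c; rewrite -(tclass_repr a) -(tclass_repr b) -(tclass_repr c).
move: (repr a) (repr b) (repr c) => x y z.
rewrite !Lambda_addE -(Lambda_addE (tdsum x y)); apply/esym.
apply: (@tdsum_class _ _ (fun n => mdim (x n) + mdim (y n))%N) => n.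
  by apply: bdiag_corner; exact: mdimP.
by rewrite /= /dsum bdiagA//; exact: mdimP.
Qed.

Lemma Lambda_addC : commutative Lambda_add.
Proof.
move=> a b; rewrite -(tclass_repr a) -(tclass_repr b).
move: (repr a) (repr b) => x y; rewrite !Lambda_addE.
by apply/tclassP; split; apply: precsim_bdiagC (tdsumE _ _) (tdsumE _ _) _ => n; exact: mdimP.
Qed.

Lemma Lambda_add0 : left_id (tclass (tzero R)) Lambda_add.
Proof.
move=> a; rewrite -(tclass_repr a); move: (repr a) => x.
apply: (@tdsum_class _ _ (fun=> 0%N)) => n; last by rewrite bdiag0x.
by move=> i j /=; rewrite eqxx.
Qed.

HB.instance Definition _ := GRing.isNmodule.Build (Lambda R)
  Lambda_addA Lambda_addC Lambda_add0.

Lemma Lambda_le_refl a : Lambda_le a a.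
Proof. exact: precsim_refl. Qed.

Lemma Lambda_le_anti a b : Lambda_le a b -> Lambda_le b a -> a = b.
Proof.
by move=> ab ba; rewrite -(tclass_repr a) -(tclass_repr b); apply/tclassP.
Qed.

Lemma Lambda_le_trans b a c : Lambda_le a b -> Lambda_le b c -> Lambda_le a c.
Proof. exact: precsim_trans. Qed.

Lemma Lambda_ge0 a : Lambda_le 0 a.
Proof.
rewrite -(tclass_repr a); apply/Lambda_leE => n; exists 0%N.
by exists 0, 0; rewrite !rmul0.
Qed.

Lemma Lambda_leD2r c a b : Lambda_le a b -> Lambda_le (a + c) (b + c).
Proof.
rewrite -(tclass_repr a) -(tclass_repr b) -(tclass_repr c).
move: (repr a) (repr b) (repr c) => x y z /Lambda_leE xy.
rewrite -[tclass x + _]/(Lambda_add _ _) -[tclass y + _]/(Lambda_add _ _).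
rewrite !Lambda_addE; apply/Lambda_leE.
apply: precsim_bdiag (tdsumE _ _) (tdsumE _ _) _ xy (precsim_refl z).
by move=> n; exact: mdimP.
Qed.

HB.instance Definition _ := isPositivelyOrdered.Build (Lambda R)
  Lambda_le_refl Lambda_le_anti Lambda_le_trans Lambda_ge0 Lambda_leD2r.

End LambdaMonoid.

Section LambdaMap.
Variables (R S : rngType) (f : {rngmorphism R -> S}).

Lemma tmap_subproof (x : Tseq R) n :
  precsim1 (map_minf f (x n)) (map_minf f (x n.+1)).
Proof. exact/precsim1_morph/tseqP. Qed.

Definition tmap (x : Tseq R) := TSeq (tmap_subproof x).

Definition Lambda_map (a : Lambda R) : Lambda S := tclass (tmap (repr a)).

Lemma Lambda_map_class (x : Tseq R) :
  Lambda_map (tclass x) = tclass (tmap x).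
Proof.
have [rx xr] := repr_tclass x.
apply/tclassP; split=> n; [have [m h] := rx n|have [m h] := xr n];
  by exists m; exact: precsim1_morph.
Qed.

End LambdaMap.

Section SMonoid.
Variable R : rngType.

Definition calS : set (Tseq R) :=
  [set x | forall n, exists y : minf R, x n = y ** x n.+1 ** x n].

Definition in_S : {pred Lambda R} :=
  fun a => `[< exists2 x, calS x & tclass x = a >].

(* This set of classes is closed under addition although [tdsum] need not      *)
(* preserve [calS]: the blocks of consecutive terms may be misaligned, so     *)
(* [S_closed] uses an equivalent sequence.                                    *)
Record Smonoid := SMon { Sval : Lambda R; _ : in_S Sval }.

HB.instance Definition _ := [isSub for Sval].
HB.instance Definition _ := [Choice of Smonoid by <:].

Lemma S_closed : Algebra.nmod_closed in_S.
Proof.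
split.
  apply/asboolP; exists (tzero R) => //.
  by move=> n; exists 0; rewrite !rmul0.
move=> a b /asboolP[x Sx <-] /asboolP[y Sy <-]; apply/asboolP.
have Tw n : precsim1 (blk (par R) (par R) (x n) 0 0 (y n))
                     (blk (par R) (par R) (x n.+1) 0 0 (y n.+1)).
  by apply: precsim1_blk => //; exact: tseqP.
exists (TSeq Tw).
  move=> n; have [u xu] := Sx n; have [v yv] := Sy n.
  by exists (blk (par R) (par R) u 0 0 v); rewrite /= !mul_dblk// -xu -yv.
rewrite -[RHS]/(Lambda_add _ _) Lambda_addE; apply/tclassP.
split=> n; exists n.+1; rewrite /= ?/dsum ?bdiagE; apply: precsim1_blk;
  rewrite ?bdiagE; try exact: tseqP.
- exact/corner_dom/mdimP.
- by [].
Qed.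

HB.instance Definition _ :=
  GRing.SubChoice_isSubNmodule.Build (Lambda R) in_S Smonoid S_closed.
Definition S_le (a b : Smonoid) := Sval a <=m Sval b.

Lemma S_le_anti a b : S_le a b -> S_le b a -> a = b.
Proof. by move=> ab ba; apply/val_inj/pole_anti. Qed.

Lemma S_le_trans b a c : S_le a b -> S_le b c -> S_le a c.
Proof. exact: pole_trans. Qed.

Lemma S_ge0 a : S_le 0 a.
Proof. by rewrite /S_le -[Sval 0]/(val _) raddf0; exact: pole0. Qed.

Lemma S_leD2r c a b : S_le a b -> S_le (a + c) (b + c).
Proof.
rewrite /S_le -[Sval (a + c)]/(val _) -[Sval (b + c)]/(val _) !raddfD.
exact: pole_add2r.
Qed.

HB.instance Definition _ := isPositivelyOrdered.Build Smonoid
  (fun a => pole_refl (Sval a)) S_le_anti S_le_trans S_ge0 S_leD2r.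

End SMonoid.

Section SMap.
Variables (R S : rngType) (f : {rngmorphism R -> S}).

Lemma S_map_subproof (a : Smonoid R) : in_S (Lambda_map f (Sval a)).
Proof.
case: a => a /= /asboolP[x Sx <-]; apply/asboolP; exists (tmap f x).
  by move=> n; have [y xy] := Sx n; exists (map_minf f y); rewrite /= {1}xy !rmorphMr.
by rewrite Lambda_map_class.
Qed.

Definition S_map (a : Smonoid R) : Smonoid S := SMon (S_map_subproof a).

End SMap.

Definition dense_rng (R : rngType) := forall x y : minf R,
  precsim1 x y -> exists z, precsim1 x z /\ precsim1 z y.

Definition left_normal (R : rngType) := forall a b c : minf R,
  a = b ** a -> b = c ** b ->
  exists d e, [/\ a = d ** a, d = e ** d & e = c ** e].

Definition directed disp (Omega : preorderType disp) :=
  (exists l : Omega, True) /\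
  (forall l m : Omega, exists n, (l <= n)%O /\ (m <= n)%O).

Record rng_system disp (Omega : preorderType disp) := RngSystem {
  rsys :> Omega -> rngType;
  rsys_map : forall l m, (l <= m)%O -> {rngmorphism rsys l -> rsys m};
  rsys_id : forall l (ll : (l <= l)%O) (x : rsys l), rsys_map ll x = x;
  rsys_comp : forall l m n (lm : (l <= m)%O) (mn : (m <= n)%O) (ln : (l <= n)%O)
    (x : rsys l), rsys_map mn (rsys_map lm x) = rsys_map ln x
}.

Section RngLimit.
Context {disp : Order.disp_t} {Omega : preorderType disp}.
Variable R : rng_system Omega.

Definition rng_cocone (A : rngType) (g : forall l, {rngmorphism R l -> A}) :=
  forall l m (lm : (l <= m)%O) (x : R l), g m (rsys_map R lm x) = g l x.

Definition is_rng_limit (L : rngType) (phi : forall l, {rngmorphism R l -> L}) :=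
  rng_cocone phi /\
  forall (A : rngType) (g : forall l, {rngmorphism R l -> A}), rng_cocone g ->
    exists u : {rngmorphism L -> A},
      (forall l x, u (phi l x) = g l x) /\
      (forall v : {rngmorphism L -> A},
         (forall l x, v (phi l x) = g l x) -> v =1 u).

End RngLimit.

Section CuLimit.
Context {disp : Order.disp_t} {Omega : preorderType disp}.
Variables (M : Omega -> poMonoidType) (f : forall l m, (l <= m)%O -> M l -> M m).

Record Cu_system : Prop := CuSystem {
  Cu_sys_obj : forall l, is_Cu (M l);
  Cu_sys_mor : forall l m (lm : (l <= m)%O), Cu_morphism (f lm);
  Cu_sys_id : forall l (ll : (l <= l)%O) (x : M l), f ll x = x;
  Cu_sys_comp : forall l m n (lm : (l <= m)%O) (mn : (m <= n)%O)
    (ln : (l <= n)%O) (x : M l), f mn (f lm x) = f ln x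
}.

Record Cu_cocone (N : poMonoidType) (g : forall l, M l -> N) : Prop := CuCocone {
  Cu_cocone_obj : is_Cu N;
  Cu_cocone_mor : forall l, Cu_morphism (g l);
  Cu_cocone_comm : forall l m (lm : (l <= m)%O) (x : M l), g m (f lm x) = g l x
}.

Definition is_Cu_limit (L : poMonoidType) (phi : forall l, M l -> L) :=
  [/\ Cu_system, Cu_cocone phi &
   forall (N : poMonoidType) (g : forall l, M l -> N), Cu_cocone g ->
     exists u : L -> N,
       [/\ Cu_morphism u, forall l x, u (phi l x) = g l x &
        forall v : L -> N, Cu_morphism v ->
          (forall l x, v (phi l x) = g l x) -> v =1 u]].

End CuLimit.

Section RngLimitExists.
Context {disp : Order.disp_t} {Omega : preorderType disp}.
Variables (R : rng_system Omega) (dirO : directed Omega).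

Definition dlpre := {l : Omega & R l}.

HB.instance Definition _ := gen_eqMixin dlpre.
HB.instance Definition _ := gen_choiceMixin dlpre.

Definition dleq : rel dlpre := fun a b => `[< exists n
  (an : (projT1 a <= n)%O) (bn : (projT1 b <= n)%O),
  rsys_map R an (projT2 a) = rsys_map R bn (projT2 b) >].

Lemma dleq_refl : reflexive dleq.
Proof. by move=> [l x]; apply/asboolP; exists l, (lexx l), (lexx l). Qed.

Lemma dleq_sym : symmetric dleq.
Proof.
by move=> a b; apply/asboolP/asboolP => -[n [an [bn e]]]; exists n, bn, an.
Qed.

Lemma dleq_trans : transitive dleq.
Proof.
move=> [m y] [l x] [n z] /asboolP[p /= [lp [mp xy]]] /asboolP[q /= [mq [nq yz]]].
apply/asboolP; have [r [pr qr]] := dirO.2 p q.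
exists r, (le_trans lp pr), (le_trans nq qr) => /=.
rewrite -(rsys_comp lp pr) xy (rsys_comp mp pr (le_trans mq qr)).
by rewrite -(rsys_comp mq qr) yz (rsys_comp nq qr (le_trans nq qr)).
Qed.

Canonical dl_equiv := EquivRel dleq dleq_refl dleq_sym dleq_trans.

Definition dirlim := {eq_quot dl_equiv}.

HB.instance Definition _ := Choice.on dirlim.
HB.instance Definition _ := EqQuotient.on dirlim.

Definition dlin l (x : R l) : dirlim := \pi_dirlim (existT (fun l => R l) l x).

Lemma dlinP l m (x : R l) (y : R m) : dlin x = dlin y <->
  exists n (ln : (l <= n)%O) (mn : (m <= n)%O), rsys_map R ln x = rsys_map R mn y.
Proof. by split=> [/eqmodP/asboolP|e] //; apply/eqmodP/asboolP. Qed.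

Lemma dlin_map l m (lm : (l <= m)%O) (x : R l) : dlin (rsys_map R lm x) = dlin x.
Proof.
by apply/dlinP; exists m, (lexx m), lm; rewrite rsys_id.
Qed.

Lemma dlin_surj (a : dirlim) : exists l (x : R l), a = dlin x.
Proof.
exists (projT1 (repr a)), (projT2 (repr a)).
by case: (repr a) (reprK a) => l x /= <-.
Qed.

Lemma dlin_surj2 (a b : dirlim) : exists l (x y : R l), a = dlin x /\ b = dlin y.
Proof.
have [l [x ->]] := dlin_surj a; have [m [y ->]] := dlin_surj b.
have [n [ln mn]] := dirO.2 l m.
by exists n, (rsys_map R ln x), (rsys_map R mn y); rewrite !dlin_map.
Qed.

Lemma dlin_surj3 (a b c : dirlim) :
  exists l (x y z : R l), [/\ a = dlin x, b = dlin y & c = dlin z].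
Proof.
have [l [x [y [-> ->]]]] := dlin_surj2 a b; have [m [z ->]] := dlin_surj c.
have [n [ln mn]] := dirO.2 l m.
exists n, (rsys_map R ln x), (rsys_map R ln y), (rsys_map R mn z).
by rewrite !dlin_map.
Qed.

Definition dlrep (a b : dirlim) :
  {l : Omega & {xy : R l * R l | a = dlin xy.1 /\ b = dlin xy.2}}.
Proof.
have /cid[l /cid[x /cid[y xy]]] := dlin_surj2 a b.
by exists l, (x, y).
Defined.

Definition dlop2 (op : forall l, R l -> R l -> R l) (a b : dirlim) : dirlim :=
  let xy := projT2 (dlrep a b) in dlin (op _ (sval xy).1 (sval xy).2).

Lemma dlop2E (op : forall l, R l -> R l -> R l) :
  (forall l m (lm : (l <= m)%O) x y,
     rsys_map R lm (op l x y) = op m (rsys_map R lm x) (rsys_map R lm y)) ->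
  forall l (x y : R l), dlop2 op (dlin x) (dlin y) = dlin (op l x y).
Proof.
move=> opP l x y; rewrite /dlop2; case: dlrep => m [[x' y'] /= [/dlinP xx' /dlinP yy']].
have [n1 [ln1 [mn1 e1]]] := xx'; have [n2 [ln2 [mn2 e2]]] := yy'.
have [n [n1n n2n]] := dirO.2 n1 n2.
have ln := le_trans ln1 n1n; have mn := le_trans mn1 n1n.
rewrite -(dlin_map ln (op l x y)) -(dlin_map mn) !opP.
rewrite -(rsys_comp ln1 n1n ln) e1 (rsys_comp mn1 n1n mn).
by rewrite -(rsys_comp ln2 n2n ln) e2 (rsys_comp mn2 n2n mn).
Qed.

Definition dlzero : dirlim := dlin (0 : R (sval (cid dirO.1))).
Definition dladd := dlop2 (fun _ x y => x + y).
Definition dlmul := dlop2 (fun _ x y => x ** y).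
Definition dlopp (a : dirlim) := dlop2 (fun _ x _ => - x) a a.

Lemma dlzeroE l : dlzero = dlin (0 : R l).
Proof.
apply/dlinP; have [n [ln mn]] := dirO.2 (sval (cid dirO.1)) l.
by exists n, ln, mn; rewrite !raddf0.
Qed.

Lemma dladdE l (x y : R l) : dladd (dlin x) (dlin y) = dlin (x + y).
Proof.
by rewrite /dladd (dlop2E (op := fun _ x y => x + y))// => *; exact: raddfD.
Qed.

Lemma dlmulE l (x y : R l) : dlmul (dlin x) (dlin y) = dlin (x ** y).
Proof.
by rewrite /dlmul (dlop2E (op := fun _ x y => x ** y))// => *; exact: rmorphMr.
Qed.

Lemma dloppE l (x : R l) : dlopp (dlin x) = dlin (- x).
Proof.
by rewrite /dlopp (dlop2E (op := fun _ x _ => - x))// => *; exact: raddfN.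
Qed.

Lemma dladdA : associative dladd.
Proof.
move=> a b c; have [l [x [y [z [-> -> ->]]]]] := dlin_surj3 a b c.
by rewrite !dladdE addrA.
Qed.

Lemma dladdC : commutative dladd.
Proof.
by move=> a b; have [l [x [y [-> ->]]]] := dlin_surj2 a b; rewrite !dladdE addrC.
Qed.

Lemma dladd0 : left_id dlzero dladd.
Proof.
by move=> a; have [l [x ->]] := dlin_surj a; rewrite (dlzeroE l) dladdE add0r.
Qed.

Lemma dladdN : left_inverse dlzero dlopp dladd.
Proof.
move=> a; have [l [x ->]] := dlin_surj a.
by rewrite (dlzeroE l) dloppE dladdE addNr.
Qed.

HB.instance Definition _ :=
  GRing.isZmodule.Build dirlim dladdA dladdC dladd0 dladdN.

Lemma dlmulA : associative dlmul.
Proof.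
move=> a b c; have [l [x [y [z [-> -> ->]]]]] := dlin_surj3 a b c.
by rewrite !dlmulE rmulA.
Qed.

Lemma dlmulDl : left_distributive dlmul +%R.
Proof.
move=> a b c; have [l [x [y [z [-> -> ->]]]]] := dlin_surj3 a b c.
change (dlmul (dladd (dlin x) (dlin y)) (dlin z) =
  dladd (dlmul (dlin x) (dlin z)) (dlmul (dlin y) (dlin z))).
by rewrite !(dlmulE, dladdE) rmulDl.
Qed.

Lemma dlmulDr : right_distributive dlmul +%R.
Proof.
move=> a b c; have [l [x [y [z [-> -> ->]]]]] := dlin_surj3 a b c.
change (dlmul (dlin x) (dladd (dlin y) (dlin z)) =
  dladd (dlmul (dlin x) (dlin y)) (dlmul (dlin x) (dlin z))).
by rewrite !(dlmulE, dladdE) rmulDr.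
Qed.

HB.instance Definition _ :=
  Zmodule_isRng.Build dirlim dlmulA dlmulDl dlmulDr.

Section Injection.
Variable l : Omega.

Lemma dlin_additive : nmod_morphism (@dlin l).
Proof.
split=> [|x y]; first by rewrite -(dlzeroE l).
by rewrite -dladdE.
Qed.

HB.instance Definition _ :=
  GRing.isNmodMorphism.Build (R l) dirlim (@dlin l) dlin_additive.

Lemma dlin_mul : {morph @dlin l : x y / x ** y}.
Proof. by move=> x y; rewrite -dlmulE. Qed.

HB.instance Definition _ :=
  isRngMultiplicative.Build (R l) dirlim (@dlin l) dlin_mul.

End Injection.

Section Universal.
Variables (A : rngType) (g : forall l, {rngmorphism R l -> A}).
Hypothesis gP : rng_cocone g.

Definition dlu (a : dirlim) : A := let _ := gP in g _ (projT2 (repr a)).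

Lemma dluE l (x : R l) : dlu (dlin x) = g l x.
Proof.
rewrite /dlu; set a := repr _.
have /dlinP[n [ln [mn e]]] : dlin (projT2 a) = dlin x.
  by rewrite /a; case: (repr _) (reprK (dlin x)) => m y /= <-.
by rewrite -(gP ln) e gP.
Qed.

Lemma dlu_additive : nmod_morphism dlu.
Proof.
split=> [|a b]; first by rewrite [0](dlzeroE (sval (cid dirO.1))) dluE raddf0.
have [l [x [y [-> ->]]]] := dlin_surj2 a b.
by rewrite -raddfD !dluE raddfD.
Qed.

HB.instance Definition _ := GRing.isNmodMorphism.Build dirlim A dlu dlu_additive.

Lemma dlu_mul : {morph dlu : x y / x ** y}.
Proof.
move=> a b; have [l [x [y [-> ->]]]] := dlin_surj2 a b.
by rewrite -rmorphMr !dluE rmorphMr.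
Qed.

HB.instance Definition _ := isRngMultiplicative.Build dirlim A dlu dlu_mul.

End Universal.

Lemma dirlimP :
  is_rng_limit (L := dirlim) (fun l => @dlin l : {rngmorphism R l -> dirlim}).
Proof.
split=> [l m lm x|A g gP]; first exact: dlin_map.
exists (dlu gP : {rngmorphism dirlim -> A}); split=> [l x|v vP a].
  exact: dluE.
by have [l [x ->]] := dlin_surj a; rewrite vP; apply/esym/dluE.
Qed.

End RngLimitExists.

Theorem rng_limit_exists disp (Omega : preorderType disp) (R : rng_system Omega) :
  directed Omega ->
  exists (L : rngType) (phi : forall l, {rngmorphism R l -> L}), is_rng_limit phi.
Proof.
move=> dirO; exact: (ex_intro _ _ (ex_intro _ _ (@dirlimP _ _ R dirO))).
Qed.

(* Main.v *)
From HB Require Import structures.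
Require Import Defs.
From mathcomp Require Import all_boot all_order ssralg.
From mathcomp Require Import boolp classical_sets.

(** Both halves of the theorem are instances of one statement about completions
    by sequences.

    Let [B] be a set with a transitive relation [prec] and a sum, and form the
    classes of [prec]-increasing sequences, ordered by cofinality. If [prec]
    interpolates, this is an object of Cu: suprema are diagonal sequences
    ([diagonal], [sup_exists]), and [a] is way below [b] exactly when a sequence
    for [a] is bounded by a single term of a sequence for [b]
    ([bounded_way_below], [way_below_bounded]), which turns the axioms into
    statements about single elements ([completion_is_Cu]).

    [Lambda R] is the completion of the finite matrices for [precsim1], and
    density of [R] is interpolation. For [Smonoid R] the right relation is
    [approx_unital]: [x] lies below some [a] with [a = b ** a] and [b = c ** b],
    where [c] lies below [y]. A sequence with [x n = y ** x n.+1 ** x n]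
    increases for it in steps of four ([strong_chain_approx]), and a sequence
    increasing for it is equivalent to one of that kind ([approx_chain_strong]);
    left normality inserts arbitrarily many local left units between [a] and
    [c], which gives interpolation ([approx_unital_interpolate]).

    Each instance of these relations, and each of the equations above, involves
    finitely many matrices, hence finitely many ring elements. So it holds in
    the limit ring if and only if it holds at some stage, and density and left
    normality pass to the limit. Finally, a cocone in Cu is a limit as soon as
    the images of the stages interpolate in it and every inequality between
    images comes, after shrinking the left side by the way-below relation, from
    an inequality at a later stage ([Cu_limit_criterion]); both conditions only
    ask to move one pair of matrices back to a stage. *)

Set Implicit Arguments.
Unset Strict Implicit.
Unset Printing Implicit Defensive.

Import Order.TTheory GRing.Theory.
Local Open Scope ring_scope.

#[local] Arguments pole_trans {s y x z} _ _.
#[local] Arguments pole_anti {s x y} _ _.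
#[local] Arguments pole_add2r {s} z {x y} _.

(** * Positively ordered monoids *)

Section CuBasics.
Variable M : poMonoidType.
Implicit Types (x y : M) (u : nat -> M).

Lemma pole_add x x' y y' : x <=m x' -> y <=m y' -> x + y <=m x' + y'.
Proof.
move=> xx yy; apply: pole_trans (pole_add2r _ xx) _.
by rewrite ![x' + _]addrC; exact: pole_add2r.
Qed.

Lemma is_sup_uniq u x y : is_sup u x -> is_sup u y -> x = y.
Proof. by move=> [ux lx] [yu ly]; apply: pole_anti; [exact: lx|exact: ly]. Qed.

Lemma increasing_le u m n : increasing u -> (m <= n)%N -> u m <=m u n.
Proof.
move=> zi; elim: n => [|n IH]; first by rewrite leqn0 => /eqP->; exact: pole_refl.
rewrite leq_eqVlt => /predU1P[->|]; first exact: pole_refl.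
by rewrite ltnS => /IH h; exact: pole_trans h (zi n).
Qed.

Lemma way_belowW x y : way_below x y -> x <=m y.
Proof.
move=> xy; have [||_ h] := xy (fun=> y) y _ _ (pole_refl y) => //.
- by move=> n; exact: pole_refl.
- by split=> [n|s /(_ 0%N)]; [exact: pole_refl|].
Qed.

Lemma way_below_le x x' y' y :
  x <=m x' -> way_below x' y' -> y' <=m y -> way_below x y.
Proof.
move=> xx xy yy u s zi zs ys; have [m h] := xy u s zi zs (pole_trans yy ys).
by exists m; exact: pole_trans xx h.
Qed.

Lemma way_below_increasing u :
  (forall n, way_below (u n) (u n.+1)) -> increasing u.
Proof. by move=> zP n; exact: way_belowW. Qed.

Lemma way_below_interpolate (x y : M) : is_Cu M -> way_below x y ->
  exists z, way_below x z /\ way_below z y.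
Proof.
move=> MC xy; have [z [zz zs]] := Cu_O2 MC y.
have [m xm] := xy z y (way_below_increasing zz) zs (pole_refl y).
exists (z m.+1); split; first exact: way_below_le xm (zz m) (pole_refl _).
exact: way_below_le (pole_refl _) (zz m.+1) (zs.1 _).
Qed.

End CuBasics.

(** * A criterion for limits in Cu *)

Section CuLimitCriterion.
Context {disp : Order.disp_t} {Omega : preorderType disp}.
Variables (M : Omega -> poMonoidType) (f : forall l m, (l <= m)%O -> M l -> M m).
Variables (L : poMonoidType) (psi : forall l, M l -> L).
Arguments f {l m}.
Arguments psi {l}.
Hypothesis dirO : directed Omega.
Hypothesis sysM : Cu_system (@f).
Hypothesis coneL : Cu_cocone (@f) (@psi).
Hypothesis psi_dense : forall a b : L, way_below a b ->
  exists l (c : M l), a <=m psi c /\ psi c <=m b.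
Hypothesis psi_reflect : forall l (c' c d : M l), way_below c' c ->
  psi c <=m psi d -> exists m (lm : (l <= m)%O), f lm c' <=m f lm d.

Let stage := {l : Omega & M l}.
Let Psi (d : stage) : L := psi (projT2 d).

(** The image of [d] approximates [b] with room to spare at the stage of [d]:
    [lower d b] is stronger than [way_below (Psi d) b]. The extra room at the
    stage is what makes [psi_reflect] applicable to [d]. *)
Definition lower (d : stage) (b : L) :=
  exists c : M (projT1 d), way_below (projT2 d) c /\ psi c <=m b.

Lemma lower_le d b b' : lower d b -> b <=m b' -> lower d b'.
Proof. by move=> [c [dc cb]] bb; exists c; split=> //; exact: pole_trans cb bb. Qed.

Lemma Psi_lower d b : lower d b -> Psi d <=m b.
Proof.
move=> [c [dc cb]]; apply: pole_trans cb.
exact/(Cu_mor_le (Cu_cocone_mor coneL _))/way_belowW.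
Qed.

(** This plays the role of compactness: the way-below relation at the stage of
    [d] can be interpolated, and one half of it survives in [L], where it picks
    a term of the sequence. *)
Lemma lower_sup d z s : increasing z -> is_sup z s -> lower d s ->
  exists n, lower d (z n).
Proof.
move=> zi zs [c [dc cs]].
have [e [de ec]] := way_below_interpolate (Cu_sys_obj sysM _) dc.
have [n en] := Cu_mor_ll (Cu_cocone_mor coneL _) ec zi zs cs.
by exists n, e.
Qed.

(** [psi_dense] yields an element [c] of a stage between [a] and [b]; since [psi]
    preserves suprema, an approximant of [c] still lies above [a]. *)
Lemma lower_between a b : way_below a b ->
  exists d : stage, a <=m Psi d /\ lower d b.
Proof.
move=> ab; have [x [ax xb]] := way_below_interpolate (Cu_cocone_obj coneL) ab.
have [l [c [xc cb]]] := psi_dense xb.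
have [e [ee ec]] := Cu_O2 (Cu_sys_obj sysM l) c.
have psie := Cu_mor_sup (Cu_cocone_mor coneL l) (way_below_increasing ee) ec.
have [n an] : exists n, a <=m psi (e n).
  apply: (ax _ _ _ psie xc) => n.
  exact: (Cu_mor_le (Cu_cocone_mor coneL _)) (way_below_increasing ee n).
exists (existT _ l (e n)); split=> //; exists (e n.+1); split=> //=.
exact: pole_trans (psie.1 _) cb.
Qed.

(** Such a [d] presents [b] by stages alone, so its image in any other cocone is
    an increasing sequence, by [psi_reflect]. *)
Definition approximates (d : nat -> stage) (b : L) :=
  is_sup (Psi \o d) b /\ forall n, lower (d n) (Psi (d n.+1)).

Lemma approximation b : exists d, approximates d b.
Proof.
have [z [zz zb]] := Cu_O2 (Cu_cocone_obj coneL) b.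
have /choice[d dP] n := lower_between (zz n).
exists d; split=> [|n]; last exact: lower_le (dP n).2 (dP n.+1).1.
split=> [n|y yP].
  exact: pole_trans (Psi_lower (dP n).2) (zb.1 _).
by apply: zb.2 => n; exact: pole_trans (dP n).1 (yP n).
Qed.

Lemma approximates_increasing d b : approximates d b -> increasing (Psi \o d).
Proof. by move=> [_ dP] n; exact: Psi_lower. Qed.

Lemma approximates_lower d b n : approximates d b -> lower (d n) b.
Proof. by move=> [db dP]; apply: lower_le (dP n) (db.1 _). Qed.

Section Factor.
Variables (N : poMonoidType) (g : forall l, M l -> N).
Arguments g {l}.
Hypothesis coneN : Cu_cocone (@f) (@g).

Let G (d : stage) : N := g (projT2 d).

(** The only use of [psi_reflect]: an inequality between images in [L] forces
    the same inequality in every other cocone. *)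
Lemma lower_G d d' : lower d (Psi d') -> G d <=m G d'.
Proof.
case: d d' => l d [m d'] [c /= [dc cd]].
have [n [ln mn]] := dirO.2 l m.
have [k [nk]] : exists k (nk : (n <= k)%O), f nk (f ln d) <=m f nk (f mn d').
  apply: (@psi_reflect n _ (f ln c)).
    exact: Cu_mor_ll (Cu_sys_mor sysM ln) _ _ dc.
  by rewrite !(Cu_cocone_comm coneL).
move=> /(Cu_mor_le (Cu_cocone_mor coneN k)).
by rewrite !(Cu_cocone_comm coneN).
Qed.

Lemma approximates_G d b : approximates d b -> increasing (G \o d).
Proof. by move=> [_ dP] n; exact: lower_G. Qed.

(** The value of the factoring map at [b] must be the supremum of the images of
    the [d] below [b]. Characterizing it by the whole set of such [d], instead
    of by a chosen approximating sequence, makes it independent of choices. *)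
Lemma factor_spec b : exists s : N,
  (forall d, lower d b -> G d <=m s) /\
  (forall y, (forall d, lower d b -> G d <=m y) -> s <=m y).
Proof.
have [d db] := approximation b.
have [s sP] := Cu_O1 (Cu_cocone_obj coneN) (approximates_G db).
exists s; split=> [e eb|y yP].
  have [n en] := lower_sup (approximates_increasing db) db.1 eb.
  exact: pole_trans (lower_G en) (sP.1 n).
by apply: sP.2 => n; exact/yP/approximates_lower.
Qed.

Definition factor b : N := sval (cid (factor_spec b)).

Lemma factor_ub d b : lower d b -> G d <=m factor b.
Proof. by rewrite /factor; case: cid => s /= [h _]; exact: h. Qed.

Lemma factor_lub b y : (forall d, lower d b -> G d <=m y) -> factor b <=m y.
Proof. by rewrite /factor; case: cid => s /= [_ h]; exact: h. Qed.

Lemma factor_approximates d b : approximates d b -> is_sup (G \o d) (factor b).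
Proof.
move=> db; split=> [n|y yP]; first exact/factor_ub/approximates_lower.
apply: factor_lub => e eb.
have [n en] := lower_sup (approximates_increasing db) db.1 eb.
exact: pole_trans (lower_G en) (yP n).
Qed.

Lemma factor_le a b : a <=m b -> factor a <=m factor b.
Proof. by move=> ab; apply: factor_lub => d da; exact/factor_ub/(lower_le da). Qed.

Lemma factor_sup z s : increasing z -> is_sup z s ->
  is_sup (factor \o z) (factor s).
Proof.
move=> zi zs; split=> [n|y yP]; first exact/factor_le/zs.1.
apply: factor_lub => d /(lower_sup zi zs)[n dn].
exact: pole_trans (factor_ub dn) (yP n).
Qed.

Lemma factorE l (x : M l) : factor (psi x) = g x.
Proof.
apply: pole_anti.
  by apply: factor_lub => d; exact: (@lower_G d (existT _ l x)).
have [z [zz zx]] := Cu_O2 (Cu_sys_obj sysM l) x.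
apply: (Cu_mor_sup (Cu_cocone_mor coneN l) (way_below_increasing zz) zx).2 => n.
apply: (@factor_ub (existT _ l (z n))); exists (z n.+1); split=> //=.
exact/(Cu_mor_le (Cu_cocone_mor coneL l))/zx.1.
Qed.

Lemma factor_way_below a b : way_below a b -> way_below (factor a) (factor b).
Proof.
move=> /lower_between[d [ad [c [dc cb]]]].
apply: (@way_below_le _ _ (g (projT2 d)) (g c)).
- by rewrite -factorE; exact: factor_le.
- exact: Cu_mor_ll (Cu_cocone_mor coneN _) _ _ dc.
- by rewrite -factorE; exact: factor_le.
Qed.

(** Directedness moves both elements to one stage, where the way-below relation
    is additive; the same element [e] then serves for both cocones. *)
Lemma stage_add d d' : exists e : stage, [/\ Psi e = Psi d + Psi d',
  G e = G d + G d' &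
  forall b b', lower d b -> lower d' b' -> lower e (b + b')].
Proof.
case: d d' => l d [l' d']; have [n [ln ln']] := dirO.2 l l'.
have psiD := (Cu_morD (Cu_cocone_mor coneL n)).2.
have gD := (Cu_morD (Cu_cocone_mor coneN n)).2.
exists (existT _ n (f ln d + f ln' d')); split.
- by rewrite /Psi /= psiD !(Cu_cocone_comm coneL).
- by rewrite /G /= gD !(Cu_cocone_comm coneN).
move=> b b' [c /= [dc cb]] [c' /= [dc' cb']].
exists (f ln c + f ln' c'); split=> /=.
  by apply: (Cu_O3 (Cu_sys_obj sysM n)); apply: (Cu_mor_ll (Cu_sys_mor sysM _)).
by rewrite psiD !(Cu_cocone_comm coneL); exact: pole_add.
Qed.

Lemma factor_add b b' : factor (b + b') = factor b + factor b'.
Proof.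
have [d db] := approximation b; have [d' db'] := approximation b'.
have /choice[e eP] n := stage_add (d n) (d' n).
apply: pole_anti.
  apply: factor_lub => x.
  have z := Cu_O4 (Cu_cocone_obj coneL) (approximates_increasing db)
    (approximates_increasing db') db.1 db'.1.
  move=> /(lower_sup _ z)[|n].
    by move=> n; apply: pole_add;
      [exact: approximates_increasing db n|exact: approximates_increasing db' n].
  have [eE GE _] := eP n.
  rewrite /= -eE => /lower_G xe; apply: pole_trans xe _; rewrite GE.
  by apply: pole_add; apply/factor_ub/approximates_lower.
apply: (Cu_O4 (Cu_cocone_obj coneN) (approximates_G db) (approximates_G db')
  (factor_approximates db) (factor_approximates db')).2 => n /=.
have [_ <- eL] := eP n.
by apply/factor_ub/eL; exact: approximates_lower.
Qed.

Lemma factor_morphism : Cu_morphism factor.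
Proof.
split; [split=> [|a b] | exact: factor_le | exact: factor_way_below |
  exact: factor_sup]; last exact: factor_add.
have [l _] := dirO.1.
rewrite -(Cu_morD (Cu_cocone_mor coneL l)).1 factorE.
exact: (Cu_morD (Cu_cocone_mor coneN l)).1.
Qed.

Lemma factor_unique (v : L -> N) : Cu_morphism v ->
  (forall l (x : M l), v (psi x) = g x) -> v =1 factor.
Proof.
move=> vC vE b; have [d db] := approximation b.
apply: is_sup_uniq (factor_approximates db).
have -> : G \o d = (fun n => v ((Psi \o d) n)).
  by apply/funext => n /=; rewrite /Psi vE.
exact: (Cu_mor_sup vC (approximates_increasing db) db.1).
Qed.

End Factor.

Theorem Cu_limit_criterion : is_Cu_limit (@f) (@psi).
Proof.
split=> // N g gP; exists (factor gP); split.
- exact: factor_morphism.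
- by move=> l x; exact: factorE.
- by move=> v vC vE; exact: factor_unique.
Qed.

End CuLimitCriterion.

(** * Completion by increasing sequences *)

(** [prec] need not be reflexive; it behaves like a way-below relation. *)
Record basis := Basis {
  bcar :> Type;
  prec : bcar -> bcar -> Prop;
  bsum : bcar -> bcar -> bcar;
  bzero : bcar;
  prec_trans : forall x y z, prec x y -> prec y z -> prec x z;
  prec_sum : forall x x' y y', prec x x' -> prec y y' ->
    prec (bsum x y) (bsum x' y')
}.

Definition chain (B : basis) (x : nat -> B) := forall n, prec (x n) (x n.+1).

Definition interpolative (B : basis) := forall x y : B,
  prec x y -> exists z, prec x z /\ prec z y.

(** [rep x a] reads: [a] is the class of [x]. The class is a relation and not a
    map on a type of chains, so that it also fits a submonoid of [Lambda R]
    whose members have sequences outside [chain] as well. *)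
Record is_completion (B : basis) (M : poMonoidType)
    (rep : (nat -> B) -> M -> Prop) : Prop := IsCompletion {
  rep_chain : forall x a, rep x a -> chain x;
  rep_exists : forall x, chain x -> exists a, rep x a;
  rep_surj : forall a, exists x, rep x a;
  rep_le : forall x y a b, rep x a -> rep y b ->
    (a <=m b <-> forall n, exists m, prec (x n) (y m));
  rep_sum : forall x y a b, rep x a -> rep y b ->
    rep (fun n => bsum (x n) (y n)) (a + b);
  rep_zero : rep (fun=> bzero B) 0
}.

Section Chains.
Variable B : basis.

Lemma chain_lt (x : nat -> B) m n : chain x -> (m < n)%N -> prec (x m) (x n).
Proof.
move=> xc; elim: n => // n IH; rewrite ltnS leq_eqVlt => /predU1P[->|/IH xmn].
  exact: xc.
exact: prec_trans xmn (xc n).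
Qed.

Lemma chain_max (x : nat -> B) u m n : chain x -> (m <= n)%N ->
  prec u (x m) -> prec u (x n.+1).
Proof. by move=> xc mn um; apply: prec_trans um (chain_lt xc _). Qed.

(** Iterated interpolation, always against the same upper bound [y]. *)
Lemma chain_between (x y : B) : interpolative B -> prec x y ->
  exists w : nat -> B, [/\ chain w, prec x (w 0%N) & forall n, prec (w n) y].
Proof.
move=> Bi xy; have [z [xz zy]] := Bi _ _ xy.
have step (u : {u : B | prec u y}) : exists v : {v : B | prec v y},
    prec (sval u) (sval v).
  by case: u => u /= /Bi[v [uv vy]]; exists (exist _ v vy).
have [next nextP] := choice step.
pose w n := iter n next (exist _ z zy).
by exists (fun n => sval (w n)); split=> // n; exact: (svalP (w n)).
Qed.

End Chains.

Section Completion.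
Variables (B : basis) (M : poMonoidType) (rep : (nat -> B) -> M -> Prop).
Hypothesis Mc : is_completion rep.

Lemma rep_inj x a b : rep x a -> rep x b -> a = b.
Proof.
move=> xa xb; have xc := rep_chain Mc xa.
by apply: pole_anti; [apply/(rep_le Mc xa xb)|apply/(rep_le Mc xb xa)] => n;
  exists n.+1; exact: xc.
Qed.

(** A finite block of the array is dominated by a single term of the next
    row: compare the last term of each row of the block with that row. *)
Lemma row_bound (X : nat -> nat -> B) (z : nat -> M) k N :
  increasing z -> (forall i, rep (X i) (z i)) ->
  exists m, forall j i, (j <= k)%N -> (i <= N)%N -> prec (X j i) (X k.+1 m).
Proof.
move=> zi Xz.
suff [m mP] : exists m, forall j, (j <= k)%N -> prec (X j N.+1) (X k.+1 m).
  exists m => j i jk iN; apply: prec_trans (mP _ jk).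
  exact: chain_lt (rep_chain Mc (Xz j)) _.
suff: forall l, (l <= k)%N -> exists m, forall j, (j <= l)%N ->
  prec (X j N.+1) (X k.+1 m) by apply.
elim=> [|l IH] lk.
  have [m mP] := (rep_le Mc (Xz 0%N) (Xz k.+1)).1 (increasing_le zi (leq0n _)) N.+1.
  by exists m => j; rewrite leqn0 => /eqP ->.
have [m mP] := IH (ltnW lk).
have [m' mP'] := (rep_le Mc (Xz l.+1) (Xz k.+1)).1 (increasing_le zi (leqW lk)) N.+1.
exists (maxn m m').+1 => j; rewrite leq_eqVlt => /predU1P[->|/mP].
  by apply: chain_max (rep_chain Mc (Xz _)) _ mP'; exact: leq_maxr.
by apply: chain_max (rep_chain Mc (Xz _)) _; exact: leq_maxl.
Qed.

(** Choosing the next diagonal term above an ever larger finite block makes the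
    diagonal cofinal in the whole array. *)
Lemma diagonal (X : nat -> nat -> B) (z : nat -> M) :
  increasing z -> (forall i, rep (X i) (z i)) ->
  exists m : nat -> nat, chain (fun k => X k (m k)) /\
    forall j i, exists k, prec (X j i) (X k (m k)).
Proof.
move=> zi Xz; have /choice[h hP] (kN : nat * nat) := row_bound kN.1 kN.2 zi Xz.
(* the second entry bounds the columns: it covers both the last chosen
   position and the index of the row *)
pose m := fix m k := if k is k'.+1 then h (k', maxn (m k') k') else 0%N.
have mE k : m k.+1 = h (k, maxn (m k) k) by [].
exists m; split=> [k|j i].
  by rewrite mE; apply: (hP (k, _)) => //; exact: leq_maxl.
exists (maxn j i).+1; rewrite mE.
by apply: (hP (maxn j i, _)); rewrite /= !leq_max leqnn ?orbT.
Qed.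

Lemma sup_of_rows (X : nat -> nat -> B) (z : nat -> M) s y :
  (forall i, rep (X i) (z i)) -> rep y s -> (forall k, z k <=m s) ->
  (forall n, exists k m, prec (y n) (X k m)) -> is_sup z s.
Proof.
move=> Xz ys zs yX; split=> // b bP; have [w wb] := rep_surj Mc b.
apply/(rep_le Mc ys wb) => n; have [k [m yn]] := yX n.
have [i wi] := (rep_le Mc (Xz k) wb).1 (bP k) m.
by exists i; exact: prec_trans yn wi.
Qed.

Lemma sup_exists (X : nat -> nat -> B) (z : nat -> M) :
  increasing z -> (forall i, rep (X i) (z i)) ->
  exists y s, [/\ rep y s, is_sup z s & forall n, exists k m, prec (y n) (X k m)].
Proof.
move=> zi Xz; have [m [mc mX]] := diagonal zi Xz.
have [s ys] := rep_exists Mc mc.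
have yX n : exists k i, prec (X n (m n)) (X k i) by exists n.+1, (m n.+1); exact: mc.
exists (fun k => X k (m k)), s; split=> //; apply: (sup_of_rows Xz ys _ yX) => k.
by apply/(rep_le Mc (Xz k) ys) => i; have [k' ki] := mX k i; exists k'.
Qed.

Lemma sup_rows (X : nat -> nat -> B) (z : nat -> M) s y :
  increasing z -> (forall i, rep (X i) (z i)) -> is_sup z s -> rep y s ->
  forall n, exists k m, prec (y n) (X k m).
Proof.
move=> zi Xz zs ys n; have [y' [s' [ys' zs' yX]]] := sup_exists zi Xz.
move: ys'; rewrite (is_sup_uniq zs' zs) => ys'.
have [i yi] := (rep_le Mc ys ys').1 (pole_refl _) n.
by have [k [m ym]] := yX i; exists k, m; exact: prec_trans yi ym.
Qed.

Lemma bounded_way_below x a y b m : rep x a -> rep y b ->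
  (forall n, prec (x n) (y m)) -> way_below a b.
Proof.
move=> xa yb xy z s zi zs bs.
have /choice[X Xz] i := rep_surj Mc (z i); have [t ts] := rep_surj Mc s.
have [i yi] := (rep_le Mc yb ts).1 bs m.
have [k [j tj]] := sup_rows zi Xz zs ts i.
exists k; apply/(rep_le Mc xa (Xz k)) => n; exists j.
exact: prec_trans (xy n) (prec_trans yi tj).
Qed.

Hypothesis Bi : interpolative B.

(** Between consecutive terms of [y] there is room for a whole chain [w m]; it
    is bounded by a term of [y] that lies below the whole next chain, so its
    class [z m] is way below the next class. *)
Lemma completion_O2 y b : rep y b -> exists (w : nat -> nat -> B) (z : nat -> M),
  [/\ forall m, rep (w m) (z m), forall m n, prec (w m n) (y m.+1),
      forall m, way_below (z m) (z m.+1) & is_sup z b].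
Proof.
move=> yb; have yc := rep_chain Mc yb.
have /choice[w wP] m := chain_between Bi (yc m).
have /choice[z zP] m : exists a, rep (w m) a by case: (wP m) => /(rep_exists Mc).
exists w, z; split=> // [m n|m|]; first by case: (wP m).
  apply: (bounded_way_below (zP _) (zP _) (m := 0%N)) => n.
  case: (wP m) (wP m.+1) => _ _ wy [_ yw _]; exact: prec_trans (wy n) yw.
apply: (sup_of_rows zP yb) => [k|n].
  by apply/(rep_le Mc (zP k) yb) => n; exists k.+1; case: (wP k).
by exists n, 0%N; case: (wP n).
Qed.

(** The classes from [completion_O2] increase to [b], so one of them lies above
    [a]. *)
Lemma way_below_bounded x a y b : rep x a -> rep y b -> way_below a b ->
  exists m, forall n, prec (x n) (y m).
Proof.
move=> xa yb ab; have [w [z [wz wy zz zb]]] := completion_O2 yb.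
have [m am] := ab z b (way_below_increasing zz) zb (pole_refl _).
exists m.+1 => n; have [i xi] := (rep_le Mc xa (wz m)).1 am n.
exact: prec_trans xi (wy m i).
Qed.

Theorem completion_is_Cu : is_Cu M.
Proof.
split.
- move=> z zi; have /choice[X Xz] i := rep_surj Mc (z i).
  by have [y [s [_ zs _]]] := sup_exists zi Xz; exists s.
- move=> b; have [y yb] := rep_surj Mc b.
  by have [w [z [_ _ zz zb]]] := completion_O2 yb; exists z.
- move=> a' a b' b aa bb.
  have [x' xa'] := rep_surj Mc a'; have [x xa] := rep_surj Mc a.
  have [y' yb'] := rep_surj Mc b'; have [y yb] := rep_surj Mc b.
  have [m1 m1P] := way_below_bounded xa' xa aa.
  have [m2 m2P] := way_below_bounded yb' yb bb.
  apply: (bounded_way_below (rep_sum Mc xa' yb') (rep_sum Mc xa yb)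
    (m := (maxn m1 m2).+1)) => n.
  apply: prec_sum.
    exact: chain_max (rep_chain Mc xa) (leq_maxl _ _) (m1P n).
  exact: chain_max (rep_chain Mc yb) (leq_maxr _ _) (m2P n).
move=> z w s t zi wi zs wt.
have /choice[X Xz] i := rep_surj Mc (z i); have /choice[Y Yw] i := rep_surj Mc (w i).
have [x xs] := rep_surj Mc s; have [y yt] := rep_surj Mc t.
apply: (sup_of_rows (fun i => rep_sum Mc (Xz i) (Yw i)) (rep_sum Mc xs yt)).
  by move=> k; exact: pole_add (zs.1 k) (wt.1 k).
move=> n; have [k1 [m1 h1]] := sup_rows zi Xz zs xs n.
have [k2 [m2 h2]] := sup_rows wi Yw wt yt n.
pose k := maxn k1 k2.
have [i1 g1] := (rep_le Mc (Xz k1) (Xz k)).1 (increasing_le zi (leq_maxl _ _)) m1.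
have [i2 g2] := (rep_le Mc (Yw k2) (Yw k)).1 (increasing_le wi (leq_maxr _ _)) m2.
exists k, (maxn i1 i2).+1; apply: prec_sum.
  exact: chain_max (rep_chain Mc (Xz k)) (leq_maxl _ _) (prec_trans h1 g1).
exact: chain_max (rep_chain Mc (Yw k)) (leq_maxr _ _) (prec_trans h2 g2).
Qed.

End Completion.

(** * Functoriality of completions *)

Section CompletionMap.
Variables (B B' : basis) (M M' : poMonoidType).
Variables (rep : (nat -> B) -> M -> Prop) (rep' : (nat -> B') -> M' -> Prop).
Hypotheses (Mc : is_completion rep) (Mc' : is_completion rep').
Hypothesis Bi : interpolative B.
Variables (h : B -> B') (F : M -> M').
Hypothesis h_prec : forall x y, prec x y -> prec (h x) (h y).
Hypothesis h_sum : forall x y, h (bsum x y) = bsum (h x) (h y).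
Hypothesis h_zero : h (bzero B) = bzero B'.
Hypothesis F_rep : forall x a, rep x a -> rep' (h \o x) (F a).

Theorem completion_morphism : Cu_morphism F.
Proof.
have F_le a b : a <=m b -> F a <=m F b.
  have [x xa] := rep_surj Mc a; have [y yb] := rep_surj Mc b.
  move=> /(rep_le Mc xa yb) ab; apply/(rep_le Mc' (F_rep xa) (F_rep yb)) => n.
  by have [m xy] := ab n; exists m; exact: h_prec.
split=> //.
- split=> [|a b].
    apply: (rep_inj Mc' (F_rep (rep_zero Mc))).
    have -> : h \o (fun _ : nat => bzero B) = (fun=> bzero B').
      by apply/funext => n; exact: h_zero.
    exact: rep_zero.
  have [x xa] := rep_surj Mc a; have [y yb] := rep_surj Mc b.
  apply: (rep_inj Mc' (F_rep (rep_sum Mc xa yb))).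
  have -> : h \o (fun n => bsum (x n) (y n)) = fun n => bsum (h (x n)) (h (y n)).
    by apply/funext => n; exact: h_sum.
  exact: (rep_sum Mc' (F_rep xa) (F_rep yb)).
- move=> a b; have [x xa] := rep_surj Mc a; have [y yb] := rep_surj Mc b.
  move=> /(way_below_bounded Mc Bi xa yb)[m xy].
  by apply: (bounded_way_below Mc' (F_rep xa) (F_rep yb) (m := m)) => n; exact: h_prec.
move=> z s zi zs; have /choice[X Xz] i := rep_surj Mc (z i).
have [x xs] := rep_surj Mc s.
apply: (sup_of_rows Mc' (fun i => F_rep (Xz i)) (F_rep xs)) => [k|n].
  exact/F_le/zs.1.
by have [k [m xX]] := sup_rows Mc zi Xz zs xs n; exists k, m; exact: h_prec.
Qed.

End CompletionMap.

(** * Elementwise description of direct limits of rings *)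

HB.instance Definition _ (A : rngType) :=
  isRngMultiplicative.Build A A (@idfun A) (fun x y => erefl).

Lemma comp_rmorphMr (A B C : rngType) (f : {rngmorphism B -> C})
  (g : {rngmorphism A -> B}) : {morph f \o g : x y / x ** y}.
Proof. by move=> x y /=; rewrite !rmorphMr. Qed.

HB.instance Definition _ (A B C : rngType) (f : {rngmorphism B -> C})
    (g : {rngmorphism A -> B}) :=
  isRngMultiplicative.Build A C (f \o g) (comp_rmorphMr f g).

Section Stages.
Context {disp : Order.disp_t} {Omega : preorderType disp}.

Definition up_closed (Q : Omega -> Prop) :=
  forall l m, (l <= m)%O -> Q l -> Q m.

Lemma up_closed_and Q Q' : up_closed Q -> up_closed Q' ->
  up_closed (fun l => Q l /\ Q' l).
Proof. by move=> Qu Qu' l m lm [/(Qu _ _ lm) Ql /(Qu' _ _ lm)]. Qed.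

Lemma stage_and (Q Q' : Omega -> Prop) : directed Omega ->
  up_closed Q -> up_closed Q' -> (exists l, Q l) -> (exists l, Q' l) ->
  exists l, Q l /\ Q' l.
Proof.
move=> [_ dirO] Qu Qu' [l Ql] [m Qm]; have [n [ln mn]] := dirO l m.
by exists n; split; [exact: Qu Ql|exact: Qu' Qm].
Qed.

Lemma stage_forall (Q : nat -> Omega -> Prop) n : directed Omega ->
  (forall i, up_closed (Q i)) -> (forall i, exists l, Q i l) ->
  exists l, forall i, (i < n)%N -> Q i l.
Proof.
move=> dirO Qu Qe; elim: n => [|n IH]; first by have [l _] := dirO.1; exists l.
have IHu : up_closed (fun l => forall i, (i < n)%N -> Q i l).
  by move=> l m lm h i i_n; exact: Qu lm (h i i_n).
have [l [h hn]] := stage_and dirO IHu (Qu n) IH (Qe n).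
by exists l => i; rewrite ltnS leq_eqVlt => /predU1P[->|/h].
Qed.

End Stages.

(** The description of a direct limit by its elements, which is what transfers
    from [R] to the matrices over [R]. *)
Record elementwise_limit disp (Omega : preorderType disp) (R : rng_system Omega)
    (L : rngType) (phi : forall l, {rngmorphism R l -> L}) : Prop :=
  ElementwiseLimit {
    ew_comm : rng_cocone phi;
    ew_surj : forall a : L, exists l (x : R l), phi l x = a;
    ew_inj : forall l (x y : R l), phi l x = phi l y ->
      exists m (lm : (l <= m)%O), rsys_map R lm x = rsys_map R lm y
  }.

Definition hom_stable (T : forall A : rngType, A -> A -> Prop) :=
  forall (A B : rngType) (f : {rngmorphism A -> B}) x y,
    T A x y -> T B (f x) (f y).

(** A relation that is witnessed by finitely many elements and equations has
    this property. *)
Definition finitary (T : forall A : rngType, A -> A -> Prop) :=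
  forall disp (Omega : preorderType disp) (R : rng_system Omega) (L : rngType)
    (phi : forall l, {rngmorphism R l -> L}),
  directed Omega -> elementwise_limit phi ->
  forall l (x y : R l), T L (phi l x) (phi l y) ->
    exists m (lm : (l <= m)%O), T (R m) (rsys_map R lm x) (rsys_map R lm y).

Section Elementwise.
Context {disp : Order.disp_t} {Omega : preorderType disp}.
Variables (R : rng_system Omega) (L : rngType).
Variable phi : forall l, {rngmorphism R l -> L}.
Hypothesis dirO : directed Omega.

(** The concrete direct limit satisfies it, and by the two universal properties
    [L] is isomorphic to the concrete limit under the [R l]. *)
Lemma rng_limit_elementwise : is_rng_limit phi -> elementwise_limit phi.
Proof.
move=> [phic phiU]; have [dlc dlU] := @dirlimP _ _ R dirO.
have [u [uE _]] := phiU _ _ dlc; have [v [vE _]] := dlU _ _ phic.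
split=> // [a|l x y xy].
  have [w [_ wU]] := phiU _ _ phic.
  have vu : v \o u =1 w by apply: (wU (v \o u)) => l x /=; rewrite uE vE.
  have id_w : idfun =1 w by apply: (wU idfun).
  have [l [x ux]] := dlin_surj (u a).
  by exists l, x; rewrite -vE /= -ux -[LHS]/((v \o u) a) vu -id_w.
have /dlinP[n [ln [ln' e]]] : dlin dirO x = dlin dirO y.
  by rewrite -[LHS]uE -[RHS]uE xy.
by exists n, ln; rewrite e (bool_irrelevance ln' ln).
Qed.

Hypothesis phiE : elementwise_limit phi.

Lemma lift_from l (a : L) : exists m (lm : (l <= m)%O) (x : R m), phi m x = a.
Proof.
have [k [x <-]] := ew_surj phiE a; have [m [lm km]] := dirO.2 l k.
by exists m, lm, (rsys_map R km x); exact: (ew_comm phiE).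
Qed.

Lemma stable_up_closed T l (x y : R l) : hom_stable T ->
  up_closed (fun m => exists lm : (l <= m)%O,
    T (R m) (rsys_map R lm x) (rsys_map R lm y)).
Proof.
move=> Ts m n mn [lm xy]; exists (le_trans lm mn).
by rewrite -!(rsys_comp lm mn); exact: Ts.
Qed.

Lemma stage_corner (Q : nat -> nat -> Omega -> Prop) n :
  (forall i j, up_closed (Q i j)) -> (forall i j, exists l, Q i j l) ->
  exists l, forall i j, (i < n)%N -> (j < n)%N -> Q i j l.
Proof.
move=> Qu Qe.
have rowE i := stage_forall n dirO (Qu i) (Qe i).
have rowU i : up_closed (fun l => forall j, (j < n)%N -> Q i j l).
  by move=> l m lm h j jn; exact: Qu lm (h j jn).
have [l lP] := stage_forall n dirO rowU rowE.
by exists l => i j ni nj; exact: lP.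
Qed.

(** Finitely many entries come from a common stage; the others are lifted
    to 0. *)
Lemma minf_surj (a : minf L) : exists l (x : minf (R l)), map_minf (phi l) x = a.
Proof.
have [n an] := minf_corner a.
have [|i j|l lP] := @stage_corner (fun i j l => exists x : R l, phi l x = a i j) n.
- by move=> i j l m lm [x xa]; exists (rsys_map R lm x); rewrite (ew_comm phiE).
- exact: ew_surj.
have /choice[h hP] (ij : nat * nat) : exists x : R l, (ij.1 < n)%N && (ij.2 < n)%N ->
    phi l x = a ij.1 ij.2.
  case: ij => i j /=; case: (ltnP i n) => [ni|_]; last by exists 0.
  case: (ltnP j n) => [nj|_]; last by exists 0.
  by have [x xa] := lP i j ni nj; exists x.
pose y i j : R l := if (i < n)%N && (j < n)%N then h (i, j) else 0.
have yn : corner n y by move=> i j; rewrite /y; case: ifP => //; rewrite eqxx.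
exists l, (Minf (corner_finite yn)); apply: minfP => i j /=; rewrite /y.
case: ifPn => ijn; first exact: (hP (i, j)).
rewrite raddf0; apply/esym/eqP.
by apply: contraNT ijn => /an.
Qed.

Lemma minf_inj l (x y : minf (R l)) : map_minf (phi l) x = map_minf (phi l) y ->
  exists m (lm : (l <= m)%O),
    map_minf (rsys_map R lm) x = map_minf (rsys_map R lm) y.
Proof.
move=> xy; have [n [xn yn]] := minf_corner2 x y.
have [|i j|m mP] := @stage_corner (fun i j m => exists lm : (l <= m)%O,
  rsys_map R lm (x i j) = rsys_map R lm (y i j)) n.
- by move=> i j; apply: (stable_up_closed (T := fun _ => eq)) => A B f a b ->.
- by apply: (ew_inj phiE); have := congr1 (fun z : minf L => z i j) xy.
(* the stage m need not lie above l when the corner is empty *)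
have [k [lk mk]] := dirO.2 l m.
exists k, lk; apply: minfP => i j /=.
have [/andP[ni nj]|ijn] := boolP ((i < n)%N && (j < n)%N).
  have [lm e] := mP i j ni nj.
  by rewrite -!(rsys_comp lm mk lk) e.
have zero (z : minf (R l)) : corner n z -> z i j = 0.
  by move=> zn; apply/eqP; apply: contraNT ijn => /zn.
by rewrite !zero.
Qed.

End Elementwise.

Section MinfSystem.
Context {disp : Order.disp_t} {Omega : preorderType disp}.

Definition minf_system (R : rng_system Omega) : rng_system Omega.
Proof.
refine (@RngSystem _ Omega (fun l => minf (R l) : rngType)
  (fun l m lm => map_minf (rsys_map R lm) : {rngmorphism _ -> _}) _ _).
- by move=> l ll x; apply: minfP => i j /=; exact: rsys_id.
- by move=> l m n lm mn ln x; apply: minfP => i j /=; exact: rsys_comp.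
Defined.

Lemma elementwise_minf (R : rng_system Omega) (L : rngType)
    (phi : forall l, {rngmorphism R l -> L}) : directed Omega ->
  elementwise_limit phi ->
  @elementwise_limit _ _ (minf_system R) (minf L : rngType)
    (fun l => map_minf (phi l) : {rngmorphism minf (R l) -> minf L}).
Proof.
move=> dirO phiE; split.
- by move=> l m lm x; apply: minfP => i j /=; exact: (ew_comm phiE).
- exact: minf_surj dirO phiE.
- exact: minf_inj dirO phiE.
Qed.

End MinfSystem.

(** * Relations between matrices and direct limits *)

Section Finitary.

Lemma stable_eq : hom_stable (fun A => eq).
Proof. by move=> A B f x y ->. Qed.

Lemma stable_precsim1 : hom_stable precsim1.
Proof. by move=> A B f x y; exact: precsim1_morph. Qed.

Lemma finitary_precsim1 : finitary precsim1.
Proof.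
move=> disp Omega R L phi dirO phiE l x y [s [t xy]].
have [m [lm [s' sE]]] := lift_from dirO phiE l s.
have [n [mn [t' tE]]] := lift_from dirO phiE m t.
have ln := le_trans lm mn.
have [|k [nk e]] := ew_inj phiE (l := n) (x := rsys_map R ln x)
    (y := rsys_map R mn s' ** rsys_map R ln y ** t').
  by rewrite !rmorphMr !(ew_comm phiE) sE tE.
exists k, (le_trans ln nk), (rsys_map R nk (rsys_map R mn s')), (rsys_map R nk t').
by rewrite -!(rsys_comp ln nk) e !rmorphMr.
Qed.

(** The relation whose increasing sequences represent [Smonoid R]. The two
    equations are the input of left normality; passing from [x] to [a] makes
    the relation compose with [precsim1] on the left. *)
Definition approx_unital (A : rngType) (x y : A) := exists a b c : A,
  [/\ precsim1 x a, a = b ** a, b = c ** b & precsim1 c y].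

Lemma stable_approx_unital : hom_stable approx_unital.
Proof.
move=> A B f x y [a [b [c [xa ab bc cy]]]]; exists (f a), (f b), (f c).
by split; rewrite -?rmorphMr -?ab -?bc//; exact: precsim1_morph.
Qed.

Lemma finitary_approx_unital : finitary approx_unital.
Proof.
move=> disp Omega R L phi dirO phiE l x y [a [b [c [xa ab bc cy]]]].
have [m1 [lm1 [a' aE]]] := lift_from dirO phiE l a.
have [m2 [m12 [b' bE]]] := lift_from dirO phiE m1 b.
have [m [m2m [c' cE]]] := lift_from dirO phiE m2 c.
have m1m := le_trans m12 m2m; have lm := le_trans lm1 m1m.
move: xa ab bc cy; rewrite -aE -bE -cE.
rewrite -(ew_comm phiE m1m a') -(ew_comm phiE m2m b').
rewrite -(ew_comm phiE lm x) -(ew_comm phiE lm y) -!rmorphMr.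
move: (rsys_map R m1m a') (rsys_map R m2m b') => a1 b1 xa ab bc cy.
have S1 z w := @stable_up_closed _ _ R _ m z w stable_precsim1.
have Se z w := @stable_up_closed _ _ R _ m z w stable_eq.
have [k [[mk xa'] [[mk1 ab'] [[mk2 bc'] [mk3 cy']]]]] := stage_and dirO (S1 _ _)
  (up_closed_and (Se _ _) (up_closed_and (Se _ _) (S1 _ _)))
  (finitary_precsim1 dirO phiE xa)
  (stage_and dirO (Se _ _) (up_closed_and (Se _ _) (S1 _ _))
    (ew_inj phiE ab)
    (stage_and dirO (Se _ _) (S1 _ _) (ew_inj phiE bc)
      (finitary_precsim1 dirO phiE cy))).
move: ab' bc' cy'; rewrite (bool_irrelevance mk1 mk) (bool_irrelevance mk2 mk).
rewrite (bool_irrelevance mk3 mk) !rmorphMr => ab' bc' cy'.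
exists k, (le_trans lm mk), (rsys_map R mk a1), (rsys_map R mk b1), (rsys_map R mk c').
by rewrite -!(rsys_comp lm mk).
Qed.

Lemma finitary_interpolation (T : forall A : rngType, A -> A -> Prop)
    disp (Omega : preorderType disp) (R : rng_system Omega) (L : rngType)
    (phi : forall l, {rngmorphism R l -> L}) :
  hom_stable T -> finitary T -> directed Omega -> elementwise_limit phi ->
  (forall l (x y : R l), T _ x y -> exists z, T _ x z /\ T _ z y) ->
  forall x y : L, T _ x y -> exists z, T _ x z /\ T _ z y.
Proof.
move=> Ts Tc dirO phiE Ti x y.
have [l [x' <-]] := ew_surj phiE x.
have [m [lm [y' <-]]] := lift_from dirO phiE l y.
rewrite -(ew_comm phiE lm x') => /(Tc _ _ _ _ _ dirO phiE)[n [mn /Ti[z [xz zy]]]].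
exists (phi n z).
by rewrite -(ew_comm phiE mn y') -(ew_comm phiE mn); split; exact: Ts.
Qed.

(** [left_normal R] is this property of the ring [minf R]; in this form it does
    not involve matrices. *)
Definition left_unital_split (A : rngType) := forall a b c : A,
  a = b ** a -> b = c ** b -> exists d e, [/\ a = d ** a, d = e ** d & e = c ** e].

Lemma left_unital_split_limit disp (Omega : preorderType disp)
    (R : rng_system Omega) (L : rngType) (phi : forall l, {rngmorphism R l -> L}) :
  directed Omega -> elementwise_limit phi ->
  (forall l, left_unital_split (R l)) -> left_unital_split L.
Proof.
move=> dirO phiE Rs a b c.
have [m1 [a' <-]] := ew_surj phiE a.
have [m2 [m12 [b' <-]]] := lift_from dirO phiE m1 b.
have [m [m2m [c' <-]]] := lift_from dirO phiE m2 c.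
have m1m := le_trans m12 m2m.
rewrite -(ew_comm phiE m1m a') -(ew_comm phiE m2m b') -!rmorphMr.
move: (rsys_map R m1m a') (rsys_map R m2m b') => a1 b1 ab bc.
have Se z w := @stable_up_closed _ _ R _ m z w stable_eq.
have [k [[mk ab'] [mk' bc']]] :=
  stage_and dirO (Se _ _) (Se _ _) (ew_inj phiE ab) (ew_inj phiE bc).
move: bc' ab'; rewrite (bool_irrelevance mk' mk) !rmorphMr => bc' ab'.
have [d [e [ad de ec]]] := Rs k _ _ _ ab' bc'.
exists (phi k d), (phi k e); rewrite -(ew_comm phiE mk a1) -(ew_comm phiE mk c').
by rewrite -!rmorphMr -ad -de -ec.
Qed.

End Finitary.

(** * Interpolation for local left units *)

Section ApproxUnital.
Variable A : rngType.
Implicit Types x y a b c d e : A.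

Lemma precsim1_lmul c d y : d = c ** d -> precsim1 c y -> precsim1 d y.
Proof. by move=> dc [s [t cy]]; exists s, (t ** d); rewrite {1}dc cy !rmulA. Qed.

(** [d = e ** d] alone does not give [precsim1 d e], for want of a left factor;
    a local left unit [f] of [e] supplies it. *)
Lemma precsim1_fix d e f : d = e ** d -> e = f ** e -> precsim1 d e.
Proof. by move=> de ef; exists f, d; rewrite -ef. Qed.

Lemma approx_unital_precsim1 x y : approx_unital x y -> precsim1 x y.
Proof.
move=> [a [b [c [xa ab bc cy]]]].
apply: precsim1_trans xa (precsim1_trans (precsim1_fix ab bc) _).
exact: precsim1_lmul bc cy.
Qed.

Lemma precsim1_approx_unital x y z :
  precsim1 x y -> approx_unital y z -> approx_unital x z.
Proof.
move=> xy [a [b [c [ya ab bc cz]]]]; exists a, b, c; split=> //.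
exact: precsim1_trans xy ya.
Qed.

(** Splitting repeatedly gives a chain of local left units [b0], [b1], up to
    [b4] and [e5] between [a] and [c], each fixing the previous one from the
    left. Cutting it at [b2] leaves enough units on both sides. *)
Lemma approx_unital_interpolate x y : left_unital_split A ->
  approx_unital x y -> exists z, approx_unital x z /\ approx_unital z y.
Proof.
move=> As [a [b [c [xa ab bc cy]]]].
have [b0 [e1 [ab0 b01 e1c]]] := As _ _ _ ab bc.
have [b1 [e2 [b01' b12 e2c]]] := As _ _ _ b01 e1c.
have [b2 [e3 [b12' b23 e3c]]] := As _ _ _ b12 e2c.
have [b3 [e4 [b23' b34 e4c]]] := As _ _ _ b23 e3c.
exists b2; split.
  by exists a, b0, b1; split=> //; exact: precsim1_fix b12' b23'.
have [b4 [e5 [b34' b45 e5c]]] := As _ _ _ b34 e4c.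
exists b3, b4, e5; split=> //; first exact: precsim1_fix b23' b34'.
exact: precsim1_lmul e5c cy.
Qed.

End ApproxUnital.

(** * Completions of matrices *)

Section ParitySum.
Variable R : rngType.
Implicit Types x y : minf R.

(** Block sum along the even and odd indices. It does not depend on the size of
    [x], unlike [dsum], so that it commutes with [map_minf]. *)
Definition psum x y : minf R := blk (par R) (par R) x 0 0 y.

Lemma psum_mul x y x' y' : psum x y ** psum x' y' = psum (x ** x') (y ** y').
Proof. by rewrite /psum mul_dblk. Qed.

Lemma precsim1_psum x x' y y' :
  precsim1 x x' -> precsim1 y y' -> precsim1 (psum x y) (psum x' y').
Proof. exact: precsim1_blk. Qed.

Lemma tclass_psum (s t u : Tseq R) : (forall n, u n = psum (s n) (t n)) ->
  tclass u = tclass s + tclass t.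
Proof.
move=> uE; rewrite -[RHS]/(Lambda_add _ _) Lambda_addE; apply/tclassP.
split=> n; exists n.+1; rewrite uE /= /dsum bdiagE; apply: precsim1_blk => //;
  try exact: tseqP.
exact/corner_dom/mdimP.
Qed.

End ParitySum.

Lemma map_psum (R S : rngType) (f : {rngmorphism R -> S}) (x y : minf R) :
  map_minf f (psum x y) = psum (map_minf f x) (map_minf f y).
Proof.
apply: minfP => i j; rewrite /= /blkf /=.
by case: (parf i) => k; case: (parf j) => l //=; exact: (raddf0 f).
Qed.

(** What a relation on rings needs for its increasing sequences of matrices to
    give a submonoid of [Lambda R] that is natural in [R] and compatible with
    direct limits. By [cmp_precsim1] and [cmp_absorb], [precsim1] and
    [T] compare [T]-increasing sequences in the same way. *)
Record comparison (T : forall A : rngType, A -> A -> Prop) : Prop := Comparison {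
  cmp_stable : hom_stable T;
  cmp_finitary : finitary T;
  cmp_precsim1 : forall (A : rngType) (x y : A), T A x y -> precsim1 x y;
  cmp_absorb : forall (A : rngType) (x y z : A),
    precsim1 x y -> T A y z -> T A x z;
  cmp_zero : forall A : rngType, T A 0 0;
  cmp_psum : forall (R : rngType) (x x' y y' : minf R),
    T _ x x' -> T _ y y' -> T _ (psum x y) (psum x' y')
}.

Lemma cmp_trans T (A : rngType) (x y z : A) : comparison T ->
  T A x y -> T A y z -> T A x z.
Proof. by move=> Tc /(cmp_precsim1 Tc); exact: (cmp_absorb Tc). Qed.

Definition minf_basis T (Tc : comparison T) (R : rngType) : basis :=
  @Basis (minf R) (@T (minf R)) (@psum R) 0
    (fun x y z => @cmp_trans T (minf R : rngType) x y z Tc) (@cmp_psum T Tc R).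

(** [M R] is, through [j], the submonoid of [Lambda R] of the classes of
    [T]-increasing sequences. *)
Record realizes (T : forall A : rngType, A -> A -> Prop) (M : rngType -> poMonoidType)
    (j : forall R, M R -> Lambda R) : Prop := Realizes {
  rz_le : forall R (a b : M R), a <=m b <-> j R a <=m j R b;
  rz_add : forall R, nmod_morphism (j R);
  rz_chain : forall R (a : M R), exists t : Tseq R,
    (forall n, T (minf R) (t n) (t n.+1)) /\ tclass t = j R a;
  rz_exists : forall R (t : Tseq R), (forall n, T (minf R) (t n) (t n.+1)) ->
    exists a : M R, j R a = tclass t
}.

Section Realization.
Variables (T : forall A : rngType, A -> A -> Prop) (Tc : comparison T).
Variables (M : rngType -> poMonoidType) (j : forall R, M R -> Lambda R).
Arguments T : clear implicits.
Hypothesis jT : realizes T j.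

Definition tseq_rep (R : rngType) (x : nat -> minf R) (a : M R) :=
  (forall n, T (minf R) (x n) (x n.+1)) /\
  exists t : Tseq R, tseq t = x /\ tclass t = j a.

Lemma rep_of_chain (R : rngType) (x : nat -> minf R) :
  (forall n, T (minf R) (x n) (x n.+1)) ->
  exists t : Tseq R, tseq t = x.
Proof. by move=> xc; exists (TSeq (fun n => cmp_precsim1 Tc (xc n))). Qed.

Lemma tseq_completion R :
  @is_completion (minf_basis Tc R) (M R) (@tseq_rep R).
Proof.
split.
- by move=> x a [].
- move=> x xc; have [t tx] := rep_of_chain xc.
  have [|a at_] := rz_exists jT (t := t); first by rewrite tx.
  by exists a; split=> //; exists t.
- move=> a; have [t [tc ta]] := rz_chain jT a.
  by exists t; split=> //; exists t.
- move=> x y a b [xc [s [sx sa]]] [yc [t [ty tb]]].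
  rewrite (rz_le jT) -sa -tb -[_ <=m _]/(Lambda_le _ _).
  split=> [/Lambda_leE st n|xy].
    have [m] := st n; rewrite sx ty => xy.
    by exists m.+1; exact: (cmp_absorb Tc xy (yc m)).
  apply/Lambda_leE => n; have [m xym] := xy n.
  by exists m; rewrite sx ty; exact: (cmp_precsim1 Tc xym).
- move=> x y a b [xc [s [sx sa]]] [yc [t [ty tb]]].
  have zc n : T (minf R) (psum (x n) (y n)) (psum (x n.+1) (y n.+1)).
    exact: (cmp_psum Tc (xc n) (yc n)).
  split=> //; have [u uz] := rep_of_chain zc; exists u; split=> //.
  by rewrite (rz_add jT R).2 -sa -tb; apply: tclass_psum => n; rewrite uz sx ty.
- split=> [n|]; first exact: cmp_zero.
  by exists (tzero R); rewrite (rz_add jT R).1.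
Qed.

Variable F : forall R S : rngType, {rngmorphism R -> S} -> M R -> M S.
Hypothesis jF : forall R S (f : {rngmorphism R -> S}) a,
  j (F f a) = Lambda_map f (j a).

Lemma tseq_rep_map R S (f : {rngmorphism R -> S}) x a :
  tseq_rep x a -> tseq_rep (map_minf f \o x) (F f a).
Proof.
move=> [xc [t [tx ta]]]; split=> [n|]; first exact: (cmp_stable Tc).
by exists (tmap f t); rewrite jF -ta Lambda_map_class; split=> //=; rewrite tx.
Qed.

Lemma realization_morphism R S (f : {rngmorphism R -> S}) :
  interpolative (minf_basis Tc R) -> Cu_morphism (F f).
Proof.
move=> Ri.
apply: (completion_morphism (tseq_completion R) (tseq_completion S) Ri
  (h := map_minf f)).
- by move=> x y; exact: (cmp_stable Tc (map_minf f)).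
- exact: map_psum.
- exact: (raddf0 (map_minf f)).
- by move=> x a; exact: tseq_rep_map.
Qed.

Context {disp : Order.disp_t} {Omega : preorderType disp}.
Variables (R : rng_system Omega) (L : rngType).
Variable phi : forall l, {rngmorphism R l -> L}.
Hypotheses (dirO : directed Omega) (phiE : elementwise_limit phi).
Hypothesis Ri : forall l, interpolative (minf_basis Tc (R l)).

Let mphi l : {rngmorphism minf (R l) -> minf L} := map_minf (phi l).

Lemma interpolative_limit : interpolative (minf_basis Tc L).
Proof.
exact: (finitary_interpolation (cmp_stable Tc) (cmp_finitary Tc) dirO
  (elementwise_minf dirO phiE) Ri).
Qed.

Lemma realization_id (S : rngType) (f : {rngmorphism S -> S}) (a : M S) :
  f =1 id -> F f a = a.
Proof.
move=> f1; have [x xa] := rep_surj (tseq_completion S) a.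
apply: (rep_inj (tseq_completion S) (tseq_rep_map f xa)).
suff -> : map_minf f \o x = x by [].
by apply/funext => n; apply: minfP => i k /=; exact: f1.
Qed.

Lemma realization_comp (A B C : rngType) (f : {rngmorphism A -> B})
    (g : {rngmorphism B -> C}) (h : {rngmorphism A -> C}) (a : M A) :
  g \o f =1 h -> F g (F f a) = F h a.
Proof.
move=> gf; have [x xa] := rep_surj (tseq_completion A) a.
apply: (rep_inj (tseq_completion C) (tseq_rep_map g (tseq_rep_map f xa))).
suff -> : map_minf g \o (map_minf f \o x) = map_minf h \o x by exact: tseq_rep_map.
by apply/funext => n; apply: minfP => i k /=; exact: gf.
Qed.

(** For the density condition, two consecutive terms of a sequence for [b] are
    lifted to a stage, where a chain fits between them. For the reflection
    condition, way-below at a stage bounds a sequence by one term, and the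
    single comparison of this term with a sequence for [d] is reflected. *)
Theorem realization_limit :
  is_Cu_limit (M := fun l => M (R l)) (L := M L)
    (fun l m (lm : (l <= m)%O) => F (rsys_map R lm)) (fun l => F (phi l)).
Proof.
have mE := elementwise_minf dirO phiE.
apply: Cu_limit_criterion => //.
- split=> [l|l m lm|l ll a|l m n lm mn ln a].
  + exact: completion_is_Cu (tseq_completion _) (@Ri l).
  + exact: realization_morphism (@Ri l).
  + by apply: realization_id => x; exact: rsys_id.
  + by apply: realization_comp => x; exact: rsys_comp.
- split=> [|l|l m lm a].
  + exact: completion_is_Cu (tseq_completion _) interpolative_limit.
  + exact: realization_morphism (@Ri l).
  + by apply: realization_comp => x; exact: (ew_comm phiE).
- move=> a b.
  have [x xa] := rep_surj (tseq_completion L) a.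
  have [y yb] := rep_surj (tseq_completion L) b.
  move=> /(way_below_bounded (tseq_completion L) interpolative_limit xa yb)[m xy].
  have [l [p pE]] := ew_surj mE (y m).
  have [n [ln [q qE]]] := lift_from dirO mE l (y m.+1).
  have [k [nk pq]] : exists k (nk : (n <= k)%O), T (minf (R k))
     (map_minf (rsys_map R nk) (map_minf (rsys_map R ln) p))
     (map_minf (rsys_map R nk) q).
    apply: (cmp_finitary Tc dirO mE).
    rewrite qE (ew_comm mE ln p : mphi n _ = _) pE.
    exact: (rep_chain (tseq_completion L) yb).
  have [w [wc pw wq]] := chain_between (@Ri k) pq.
  have [c wcP] := rep_exists (tseq_completion (R k)) wc.
  exists k, c; have wL := tseq_rep_map (phi k) wcP.
  have pL : mphi k (map_minf (rsys_map R nk) (map_minf (rsys_map R ln) p)) = y m.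
    by rewrite (ew_comm mE nk) (ew_comm mE ln) pE.
  have qL : mphi k (map_minf (rsys_map R nk) q) = y m.+1.
    by rewrite (ew_comm mE nk) qE.
  split.
    apply/(rep_le (tseq_completion L) xa wL) => i; exists 0%N.
    apply: (prec_trans (xy i)); rewrite -pL.
    exact: (cmp_stable Tc (mphi k) pw).
  apply/(rep_le (tseq_completion L) wL yb) => i; exists m.+1.
  by rewrite -qL; exact: (cmp_stable Tc (mphi k) (wq i)).
move=> l c' c d.
have [x' xc'] := rep_surj (tseq_completion (R l)) c'.
have [x xc] := rep_surj (tseq_completion (R l)) c.
have [y yd] := rep_surj (tseq_completion (R l)) d.
move=> /(way_below_bounded (tseq_completion _) (@Ri l) xc' xc)[i xx].
move=> /(rep_le (tseq_completion L) (tseq_rep_map (phi l) xc)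
  (tseq_rep_map (phi l) yd)) /(_ i)[k xy].
have [m [lm xym]] := cmp_finitary Tc dirO mE xy.
exists m, lm; apply/(rep_le (tseq_completion (R m)) (tseq_rep_map _ xc')
  (tseq_rep_map _ yd)) => n; exists k.
apply: (cmp_trans Tc _ xym).
exact: (cmp_stable Tc (map_minf (rsys_map R lm)) (xx n)).
Qed.

End Realization.

(** * Idempotent rings are dense *)

Section SquareRing.
Variable R : rngType.
Implicit Types s x y : minf R.

Definition unit_mxf (i j : nat) (a : R) (k l : nat) : R :=
  if (k == i) && (l == j) then a else 0.

Lemma unit_mx_corner i j a : corner (maxn i j).+1 (unit_mxf i j a).
Proof.
move=> k l; rewrite /unit_mxf; case: ifP => [/andP[/eqP-> /eqP->]|]; last by rewrite eqxx.
by rewrite !ltnS leq_maxl leq_maxr.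
Qed.

Definition unit_mx i j a : minf R := Minf (corner_finite (@unit_mx_corner i j a)).

Lemma unit_mxM i j a b : unit_mx i j (a ** b) = unit_mx i 0 a ** unit_mx 0 j b.
Proof.
apply: minfP => k l.
rewrite (@minf_mulE _ _ _ (maxn i 0).+1); last by left; exact: unit_mx_corner.
rewrite big_ord_recl big1 => [|m _]; last by rewrite /= /unit_mxf /= andbF rmul0.
rewrite addr0 /= /unit_mxf /= eqxx andbT.
by case: (k == i); case: (l == j); rewrite /= ?rmulr0 ?rmul0.
Qed.

Lemma unit_mxD i j : {morph unit_mx i j : a b / a + b}.
Proof.
by move=> a b; apply: minfP => k l /=; rewrite /unit_mxf; case: ifP; rewrite ?addr0.
Qed.

Lemma unit_mx0 i j : unit_mx i j 0 = 0.
Proof. by apply: minfP => k l /=; rewrite /unit_mxf; case: ifP. Qed.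

Lemma minf_sumE (I : Type) (r : seq I) (F : I -> minf R) i j :
  (\sum_(k <- r) F k) i j = \sum_(k <- r) F k i j.
Proof. exact: (big_morph (fun x : minf R => x i j) (fun _ _ => erefl) erefl). Qed.

Lemma sum_delta (n i : nat) (F : nat -> R) : (forall k, (n <= k)%N -> F k = 0) ->
  \sum_(k < n) (if i == k :> nat then F k else 0) = F i.
Proof.
move=> F0; rewrite -big_mkcond /=; case: (ltnP i n) => [ni|/[dup] ni /F0 ->].
  by rewrite (big_pred1 (Ordinal ni)) => // k; rewrite -val_eqE /= eq_sym.
by rewrite big_pred0 // => k /=; rewrite gtn_eqF // (leq_trans (ltn_ord k) ni).
Qed.

Lemma minf_sum_units s n : corner n s ->
  s = \sum_(i < n) \sum_(j < n) unit_mx i j (s i j).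
Proof.
move=> sn; apply: minfP => k l; rewrite minf_sumE.
under eq_bigr => i _.
  rewrite minf_sumE.
  rewrite (eq_bigr (fun j : 'I_n => if l == j then
      (if k == i then s i j else 0) else 0)); last first.
    by move=> j _; rewrite /= /unit_mxf andbC; case: (l == j).
  rewrite (@sum_delta n l (fun j => if k == i then s i j else 0)); last first.
    by move=> j nj; rewrite (corner_col _ sn nj) if_same.
  over.
rewrite (@sum_delta n k (fun i => s i l))// => i ni.
exact: corner_row sn ni.
Qed.

Definition factors s := exists x y, s = x ** y.

(** A row of two blocks times a column of two blocks is the sum of two products.
    The inner index runs over both parities; the outer one is cut at the size
    of the sum. *)
Lemma factors_add s s' : factors s -> factors s' -> factors (s + s').
Proof.
move=> [x [y ->]] [x' [y' ->]].
have [n cn] := minf_corner (x ** y + x' ** y').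
exists (blk (cut R n) (par R) x x' 0 0), (blk (par R) (cut R n) y 0 y' 0).
rewrite mul_blk // !rmul0 !rmulr0 !addr0 -bdiagE.
apply: minfP => i j; rewrite [RHS]/= /bdiagf.
case: ifPn => // ij; rewrite if_same; apply/eqP.
by apply: contraNT ij => /cn.
Qed.

Lemma factors_sum (I : Type) (r : seq I) (F : I -> minf R) :
  (forall i, factors (F i)) -> factors (\sum_(i <- r) F i).
Proof.
move=> FP; elim/big_ind: _ => //; last exact: factors_add.
by exists 0, 0; rewrite rmul0.
Qed.

Lemma minf_factors s : rng_square R = [set: R]%classic -> factors s.
Proof.
move=> R2; have [n sn] := minf_corner s.
rewrite (minf_sum_units sn); apply: factors_sum => i; apply: factors_sum => j.
have : rng_square R (s i j) by rewrite R2.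
move=> [m [a [b ->]]].
rewrite (big_morph _ (@unit_mxD i j) (@unit_mx0 i j)).
apply: factors_sum => k; rewrite unit_mxM.
by exists (unit_mx i 0 (a k)), (unit_mx 0 j (b k)).
Qed.

(** Factor the two outer matrices and regroup. *)
Theorem square_dense : rng_square R = [set: R]%classic -> dense_rng R.
Proof.
move=> R2 x y [s [t ->]].
have [s1 [s2 ->]] := minf_factors s R2; have [t1 [t2 ->]] := minf_factors t R2.
exists (s2 ** y ** t1); split; last by exists s2, t1.
by exists s1, t2; rewrite !rmulA.
Qed.

End SquareRing.

(** * The sequences that define S(R) *)

Section ProjectiveChains.
Variable A : rngType.

(** The local left units are [x n.+2 ** y n.+1] for [x n.+2 ** x n.+1], and then
    [y n.+2 ** x n.+3]. *)
Lemma strong_chain_approx (x : nat -> A) :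
  (forall n, exists y, x n = y ** x n.+1 ** x n) ->
  forall n, approx_unital (x n) (x n.+4).
Proof.
move=> /choice[y xy] n.
exists (x n.+2 ** x n.+1), (x n.+2 ** y n.+1), (y n.+2 ** x n.+3); split.
- by exists (y n ** y n.+1), (x n); rewrite {1}(xy n) {1}(xy n.+1) !rmulA.
- by rewrite -rmulA [y _ ** _]rmulA -xy.
- by rewrite rmulA -xy.
- by exists (y n.+2 ** y n.+3), (x n.+3); rewrite {1}(xy n.+3) !rmulA.
Qed.

(** Put [q n = a n.+1 ** r n ** a n], where [s n ** a n.+1 ** r n] is a local
    left unit of [a n]. Then [a n = s n ** q n], so [q n] and [a n] are left
    multiples of each other, and [q n.+1 ** r n ** s n] is, up to the left
    factor [s n.+1], a local left unit of [q n]. These products form the required sequence. *)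
Lemma approx_chain_strong (x : nat -> A) :
  (forall n, approx_unital (x n) (x n.+1)) ->
  exists w : nat -> A, [/\ forall n, exists y, w n = y ** w n.+1 ** w n,
    forall n, precsim1 (x n) (w n) & forall n, precsim1 (w n) (x n.+4)].
Proof.
move=> xc; have /choice[a aP] n : exists a b, [/\ precsim1 (x n) a, a = b ** a,
    precsim1 a (x n.+1) & precsim1 b (x n.+1)].
  have [a [b [c [xa ab bc cx]]]] := xc n.
  have bx := precsim1_lmul bc cx.
  by exists a, b; split=> //; exact: precsim1_trans (precsim1_fix ab bc) bx.
have /choice[s sP] n : exists s r, a n = s ** a n.+1 ** r ** a n.
  have [b [_ ab _ bx]] := aP n; have [_ [xa _ _ _]] := aP n.+1.
  by have [s [r bE]] := precsim1_trans bx xa; exists s, r; rewrite {1}ab bE.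
have [r {}sP] := choice sP.
pose q n := a n.+1 ** r n ** a n.
have aq n : a n = s n ** q n by rewrite {1}sP /q !rmulA.
pose w n := q n.+1 ** r n ** s n.
have qw n : q n = s n.+1 ** w n ** q n.
  rewrite {1}/q {1}aq /w; rewrite {1}aq !rmulA //.
have ww n : w n = s n.+2 ** w n.+1 ** w n by rewrite {1}/w qw /w !rmulA.
exists w; split=> n; first by exists (s n.+2); exact: ww.
- have [b [xa _ _ _]] := aP n; apply: precsim1_trans xa _.
  by exists (s n ** s n.+1), (q n); rewrite {1}aq {1}qw !rmulA.
- have [b [_ _ ax _]] := aP n.+3; apply: precsim1_trans ax.
  exists (s n.+2), (r n.+2 ** a n.+2 ** r n.+1 ** s n.+1 ** w n).
  by rewrite {1}ww {1}/w /q !rmulA.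
Qed.

End ProjectiveChains.

(** * The two instances *)

Lemma comparison_precsim1 : comparison precsim1.
Proof.
split.
- exact: stable_precsim1.
- exact: finitary_precsim1.
- by [].
- by move=> A x y z; exact: precsim1_trans.
- by move=> A; exists 0, 0; rewrite !rmul0.
- exact: precsim1_psum.
Qed.

Lemma comparison_approx_unital : comparison approx_unital.
Proof.
split.
- exact: stable_approx_unital.
- exact: finitary_approx_unital.
- exact: approx_unital_precsim1.
- exact: precsim1_approx_unital.
- have z0 (A : rngType) : precsim1 (0 : A) 0 by exists 0, 0; rewrite !rmul0.
  by move=> A; exists 0, 0, 0; rewrite rmul0.
move=> R x x' y y' [a [b [c [xa ab bc cx]]]] [a' [b' [c' [ya ab' bc' cy]]]].
exists (psum a a'), (psum b b'), (psum c c').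
by rewrite !psum_mul -ab -bc -ab' -bc'; split=> //; exact: precsim1_psum.
Qed.

Lemma realizes_Lambda :
  @realizes precsim1 (fun R => Lambda R : poMonoidType) (fun R => id).
Proof.
split=> // R; last by move=> t _; exists (tclass t).
by move=> a; exists (repr a); split; [exact: tseqP|exact: tclass_repr].
Qed.

Lemma realizes_Smonoid :
  @realizes approx_unital (fun R => Smonoid R : poMonoidType) (fun R => @Sval R).
Proof.
split=> R; first by [].
- split=> [|a b]; first by rewrite -[Sval 0]/(val _) raddf0.
  by rewrite -[Sval (a + b)]/(val _) raddfD.
- case=> a aS; have /asboolP[x Sx xa] := aS.
  have xc := strong_chain_approx Sx.
  have tc n : approx_unital (x (n * 4)%N : minf R) (x (n.+1 * 4)%N) := xc _.
  exists (TSeq (fun n => approx_unital_precsim1 (tc n))); split=> //=.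
  rewrite -xa; apply/tclassP; split=> n /=; first by exists (n * 4).+1; exact: tseqP.
  by exists n.+1; apply: tseq_lt; rewrite mulSn addSn ltnS
    (leq_trans (leq_pmulr n (isT : (0 < 4)%N)) (leq_addl _ _)).
move=> t /approx_chain_strong[w [wS tw wt]].
have wc n : precsim1 (w n) (w n.+1) by have [y wy] := wS n; exists y, (w n).
have tin : in_S (tclass t).
  apply/asboolP; exists (TSeq wc) => //; apply/tclassP.
  by split=> n; [exists n.+4; exact: wt|exists n; exact: tw].
by exists (SMon tin).
Qed.

Theorem theorem8p2 (disp : Order.disp_t) (Omega : preorderType disp)
    (R : rng_system Omega) (L : rngType)
    (phi : forall l : Omega, {rngmorphism R l -> L}) :
  directed Omega -> is_rng_limit phi ->
  [/\ (forall l, rng_square (R l) = [set: R l]%classic) ->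
        forall l, dense_rng (R l),
      (forall l, dense_rng (R l)) ->
        dense_rng L /\
        is_Cu_limit (M := fun l => Lambda (R l)) (L := Lambda L)
          (fun l m (lm : (l <= m)%O) => Lambda_map (rsys_map R lm))
          (fun l => Lambda_map (phi l)) &
      (forall l, left_normal (R l)) ->
        left_normal L /\
        is_Cu_limit (M := fun l => Smonoid (R l)) (L := Smonoid L)
          (fun l m (lm : (l <= m)%O) => S_map (rsys_map R lm))
          (fun l => S_map (phi l))].
Proof.
move=> dirO phiL; have phiE := rng_limit_elementwise dirO phiL.
split=> [R2 l|Rd|Rn]; first exact: square_dense.
- split; first exact: (interpolative_limit (Tc := comparison_precsim1) dirO phiE Rd).
  exact: (realization_limit (Tc := comparison_precsim1) realizes_Lambda
    (F := fun R S f => @Lambda_map R S f) (fun _ _ _ _ => erefl) dirO phiE Rd).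
split; first exact: (left_unital_split_limit dirO (elementwise_minf dirO phiE) Rn).
apply: (realization_limit (Tc := comparison_approx_unital) realizes_Smonoid
  (F := fun R S f => @S_map R S f) (fun _ _ _ _ => erefl) dirO phiE) => l x y.
exact: approx_unital_interpolate (Rn l).
Qed.
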